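(* Let $G$ be a connected graph of order $n$ and let $k \ge 3$ be an integer. Suppose that one of the following holds: (i) $k=3$, $n\ge 8$ and $\sigma_4(G)\ge 2n-7$; (ii) $k=4$, $n\ge 9$ and $\sigma_4(G)\ge n$; (iii) $k=5$, $n\ge 11$ and $\sigma_4(G)\ge n-1$; (iv) $k=6$, $n\ge 17$ and $\sigma_4(G)\ge \frac{n+5}{2}$; (v) $k\ge 7$, $\sigma_4(G)\ge \frac{4n-4k-7}{k+2}$, and moreover $n\ge 286$ if $k=7$, $n\ge 207$ if $k=8$, $n\ge 190$ if $k=9$, and $n> k^2+7k+18+\frac{33}{k-2}$ if $k\ge 10$. Then $cfc(G)\le k$.
   Context: All graphs are finite, without loops or multiple edges; the order of $G$ is $|V(G)|$, and $d_G(v)$ is the degree of $v$ in $G$. $\sigma_4(G)$ is the minimum of $\sum_{s\in S} d_G(s)$ over all independent sets $S\subseteq V(G)$ (no two vertices adjacent) with $|S|=4$; by convention $\sigma_4(G)=+\infty$ if $G$ has no independent set of size $4$. Given an edge-colouring of $G$ (not necessarily proper), a path is conflict-free if some colour appears on exactly one of its edges. An edge-coloured graph is conflict-free connected if every pair of distinct vertices is connected by a conflict-free path. The conflict-free connection number $cfc(G)$ of a connected graph $G$ is the minimum number of colours in an edge-colouring making $G$ conflict-free connected. *)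

(* Defs.v *)
From mathcomp Require Import all_boot all_order all_algebra.
From mathcomp Require Import boolp constructive_ereal.

Set Implicit Arguments.
Unset Strict Implicit.
Unset Printing Implicit Defensive.

Import Order.TTheory GRing.Theory Num.Theory.

Record sgraph := SGraph {
  svertex :> finType;
  adj : rel svertex;
  adj_sym : symmetric adj;
  adj_irrefl : irreflexive adj }.

Section Graph.
Variable G : sgraph.

Definition connected : bool := [forall x : G, forall y : G, connect (@adj G) x y].

Definition deg (v : G) : nat := #|[set w : G | adj v w]|.

Definition independent (S : {set G}) : bool :=
  [forall x in S, forall y in S, ~~ adj x y].

(* Valued in the extended rationals, so that the minimum over no set is +oo. *)
Definition sigma (m : nat) : \bar rat :=
  \big[Order.min/+oo%E]_(S : {set G} | independent S && (#|S| == m))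
    ((\sum_(s in S) deg s)%N%:R)%R%:E.

Definition edges : {set {set G}} :=
  [set [set xy.1; xy.2] | xy : G * G & adj xy.1 xy.2].

Definition edge : finType := {e : {set G} | e \in edges}.

Definition path_edges (x : G) (p : seq G) : seq {set G} :=
  pairmap (fun u v => [set u; v]) x p.

Definition path_between (x y : G) (p : seq G) : Prop :=
  [/\ path (@adj G) x p, last x p = y & uniq (x :: p)].

(* The edges of a path are pairwise distinct, so counting its edges of colour a
   as a set is the same as counting them along the path. *)
Definition conflict_free k (c : {ffun edge -> 'I_k}) (x : G) (p : seq G) : Prop :=
  exists a : 'I_k,
    #|[set e : edge | (val e \in path_edges x p) && (c e == a)]| = 1.

Definition cf_connected k (c : {ffun edge -> 'I_k}) : Prop :=
  forall x y : G, x != y ->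
    exists2 p : seq G, path_between x y p & conflict_free c x p.

Definition cf_colorable (k : nat) : Prop :=
  exists c : {ffun edge -> 'I_k}, cf_connected c.

Lemma cf_colorable_ex : connected -> exists k, `[< cf_colorable k >].
Proof.
move=> conn; exists #|edge|; apply/asboolP; exists [ffun e => enum_rank e].
move=> x y neq_xy; have /forallP/(_ x)/forallP/(_ y)/connectP[p0 p0P yE] := conn.
case: (shortenP p0P) yE => [[|z p] pP p_uniq _ yE].
  by move: neq_xy; rewrite yE /= eqxx.
exists (z :: p) => //.
have adj_xz : adj x z by case/andP: pP.
have xzE : [set x; z] \in edges by apply/imsetP; exists (x, z); rewrite ?inE.
pose f : edge := Sub [set x; z] xzE.
exists (enum_rank f); rewrite -[RHS](cards1 f).
apply: eq_card => e; rewrite !inE ffunE (inj_eq enum_rank_inj).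
by case: (eqVneq e f) => [->|_]; rewrite ?andbF //= ?eqxx.
Qed.

(* The least k exists because a connected graph is conflict-free connected
   when all its edges get different colours. *)
Definition cfc (conn : connected) : nat := ex_minn (cf_colorable_ex conn).

Lemma cfcP (conn : connected) (k : nat) :
  (cfc conn <= k)%N <-> exists2 j, (j <= k)%N & cf_colorable j.
Proof.
rewrite /cfc; case: ex_minnP => m /asboolP mP min; split=> [le_mk|[j le_jk jP]].
  by exists m.
exact: leq_trans (min _ (asboolT jP)) le_jk.
Qed.

End Graph.

(* Main.v *)
(** Let T be a minimal connected spanning set of edges; it contains every
    bridge.  Give one colour, say 0, to the edges outside T, another colour to
    the edges of T that are not bridges, and colour the bridges so that 0 is
    used at most once.  When the T-path from x to y contains a non-bridge t,
    some edge outside T reconnects the two parts of T - t, and going through it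
    gives a path with exactly one edge outside T.  Hence k colours suffice as
    soon as there are at most k bridges (or 4 bridges, not all at one vertex,
    when k = 3).

    If there are more bridges, the tree of 2-edge-connected components has many
    nodes.  A node with more vertices than bridges attached to it ("free")
    contains a vertex that meets no bridge, and any other node ("tight") has a
    vertex of degree at most its number of attached bridges.  Since the tree is
    bipartite, four nodes whose tight members lie on the same side yield four
    independent vertices; averaging over such choices contradicts the bound on
    sigma_4. *)

Require Import Defs.
From mathcomp Require Import all_boot all_order all_algebra.
From mathcomp Require Import boolp constructive_ereal.
From mathcomp Require Import zify lra.

Set Implicit Arguments.
Unset Strict Implicit.
Unset Printing Implicit Defensive.

Import Order.TTheory GRing.Theory Num.Theory.

(** * Colouring with few bridges *)

Section Bridges.
Variable G : sgraph.
Implicit Types (x y z u v : G) (E : {set {set G}}) (e : {set G}) (p : seq G).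

Definition restr E : rel G := fun u v => adj u v && ([set u; v] \in E).

Definition spanning E : bool := [forall x, forall y, connect (restr E) x y].

Definition bridges : {set {set G}} :=
  [set e in edges G | ~~ spanning (edges G :\ e)].

Lemma restr_sym E : symmetric (restr E).
Proof. by move=> u v; rewrite /restr adj_sym setUC. Qed.

Lemma connect_restrC E : connect_sym (restr E).
Proof. exact/sym_connect_sym/restr_sym. Qed.

Lemma restr_edges : restr (edges G) =2 @adj G.
Proof.
move=> u v; rewrite /restr; case adj_uv: (adj u v) => //=.
by apply/imsetP; exists (u, v); rewrite ?inE.
Qed.

Lemma connect_ind_closed (T : finType) (R : rel T) (A : pred T) (x y : T) :
  (forall a b, R a b -> A a -> A b) -> connect R x y -> A x -> A y.
Proof.
move=> RA /connectP[p pP ->]; elim: p x pP => //= z p IH x /andP[xz pP] Ax.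
exact: IH _ pP (RA _ _ xz Ax).
Qed.

Lemma sub_spanning E E' : E \subset E' -> spanning E -> spanning E'.
Proof.
move=> sEE' /forallP spE; apply/forallP => x; apply/forallP => y.
have /forallP/(_ y) := spE x; apply: connect_sub => {x y} u v.
by case/andP=> uv uvE; apply: connect1; rewrite /restr uv (subsetP sEE').
Qed.

Lemma spanning_edges : connected G -> spanning (edges G).
Proof.
move/forallP => conn; apply/forallP => x; apply/forallP => y.
by rewrite (eq_connect restr_edges); have /forallP/(_ y) := conn x.
Qed.

Lemma edgesP e : reflect (exists u v, adj u v /\ e = [set u; v]) (e \in edges G).
Proof.
apply: (iffP imsetP) => [[[u v]]|[u [v [uv ->]]]]; last by exists (u, v); rewrite ?inE.
by rewrite inE /= => uv ->; exists u, v.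
Qed.

(** An invariant along the walk: every other edge survives, and crossing [[set u; v]] lands on [u]
    or [v], where a walk may start afresh. *)
Lemma connectD1 E u v x :
  connect (restr E) u x ->
  connect (restr (E :\ [set u; v])) u x || connect (restr (E :\ [set u; v])) v x.
Proof.
move=> con_ux.
apply: (connect_ind_closed (A := fun x =>
  connect (restr (E :\ [set u; v])) u x || connect (restr (E :\ [set u; v])) v x)
  _ con_ux); last by rewrite connect0.
move=> a b /andP[ab abE].
have [ab_uv|neq] := eqVneq [set a; b] [set u; v].
  have: b \in [set u; v] by rewrite -ab_uv set22.
  by rewrite !inE => /orP[]/eqP->; rewrite connect0 ?orbT.
have step : restr (E :\ [set u; v]) a b by rewrite /restr ab !inE neq.
by case/orP=> /connect_trans-> //; rewrite ?orbT //; apply: connect1.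
Qed.

Lemma spanningD1 E u v :
  spanning E -> connect (restr (E :\ [set u; v])) u v ->
  spanning (E :\ [set u; v]).
Proof.
move=> /forallP spE con_uv.
have from_u x : connect (restr (E :\ [set u; v])) u x.
  have /forallP/(_ x)/connectD1-/(_ v)/orP[//|] := spE u.
  exact: connect_trans.
apply/forallP => x; apply/forallP => y.
by apply: connect_trans (from_u y); rewrite connect_restrC.
Qed.

Lemma path_edges_sub x p e z : e \in path_edges x p -> z \in e -> z \in x :: p.
Proof.
elim: p x => //= y p IH x; rewrite inE => /orP[/eqP->|/IH{}IH /IH].
  by rewrite !inE orbA => ->.
by rewrite [z \in x :: _]inE orbC => ->.
Qed.

Lemma path_edges_cat x p1 p2 :
  path_edges x (p1 ++ p2) = path_edges x p1 ++ path_edges (last x p1) p2.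
Proof. exact: pairmap_cat. Qed.

Lemma path_edgesP x p e :
  e \in path_edges x p ->
  exists p1 v p2, p = p1 ++ v :: p2 /\ e = [set last x p1; v].
Proof.
elim: p x => //= y p IH x; rewrite inE => /orP[/eqP->|/IH].
  by exists [::], y, p.
by move=> [p1 [v [p2 [-> ->]]]]; exists (y :: p1), v, p2.
Qed.

Lemma restr_pathE E x p :
  path (restr E) x p = path (@adj G) x p && all [in E] (path_edges x p).
Proof. by elim: p x => //= y p IH x; rewrite IH /restr andbACA. Qed.

Lemma path_edges_edges x p :
  path (@adj G) x p -> {subset path_edges x p <= edges G}.
Proof.
rewrite -(eq_path restr_edges) restr_pathE => /andP[_ /allP sub] e /sub.
exact.
Qed.

Lemma path_connectD1 x p e :
  path (@adj G) x p -> e \notin path_edges x p ->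
  connect (restr (edges G :\ e)) x (last x p).
Proof.
move=> pP ep; apply/connectP; exists p => //; rewrite restr_pathE pP.
apply/allP => f fp; rewrite !inE (path_edges_edges pP fp) andbT.
by apply: contraNneq ep => <-.
Qed.

Lemma uniq_path_split x p1 v p2 :
  uniq (x :: p1 ++ v :: p2) ->
  [set last x p1; v] \notin path_edges x p1 /\
  [set last x p1; v] \notin path_edges v p2.
Proof.
rewrite -cat_cons cat_uniq => /and3P[_ /hasPn dis _]; split; apply/negP.
  move=> /path_edges_sub/(_ (set22 _ _)) vp1.
  by have /negP[] := dis v (mem_head _ _).
move=> /path_edges_sub/(_ (set21 _ _))/dis/negP[]; exact: mem_last.
Qed.

(** Were the ends of the path still joined without [e], the rest of the path would join the ends of
    [e], and [e] would not be a bridge. *)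
Lemma bridge_on_path x p e :
  connected G -> e \in bridges -> path (@adj G) x p -> uniq (x :: p) ->
  e \in path_edges x p -> ~~ connect (restr (edges G :\ e)) x (last x p).
Proof.
move=> conn; rewrite inE => /andP[_ eB] pP p_uniq /path_edgesP[p1 [v [p2 [pE eE]]]].
apply: contra eB => con; rewrite eE.
apply: spanningD1; first exact: spanning_edges.
rewrite -eE; move: pP p_uniq con; rewrite {p}pE cat_path /= last_cat /=.
case/and3P=> p1P _ p2P /uniq_path_split; rewrite -eE => -[n1 n2] con.
apply: (@connect_trans _ _ x).
  by rewrite connect_restrC; apply: path_connectD1.
apply: connect_trans con _.
by rewrite connect_restrC; apply: path_connectD1.
Qed.

Lemma conflict_freeI k (c : {ffun edge G -> 'I_k}) (a : 'I_k) x p e :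
  path (@adj G) x p -> e \in path_edges x p ->
  (forall f : edge G, val f \in path_edges x p -> (c f == a) = (val f == e)) ->
  conflict_free c x p.
Proof.
move=> pP ep ca; have eE := path_edges_edges pP ep.
exists a; rewrite -[RHS](cards1 (Sub e eE : edge G)); apply: eq_card => f.
rewrite !inE -val_eqE /=; case fp: (val f \in _) => /=; first exact: ca.
by apply/esym/negbTE; apply: contraFneq fp => ->.
Qed.

(** [c0] marks the edges outside the tree, so at most one bridge may have it. A path made of bridges
    has no detour, so [col] itself must provide a unique colour there. *)
Lemma cf_colorable_bridges k (c0 c1 : 'I_k) (col : {set G} -> 'I_k) :
  connected G -> c1 != c0 ->
  {in bridges &, forall e f, col e = c0 -> col f = c0 -> e = f} ->
  (forall x p, path (@adj G) x p -> uniq (x :: p) -> p != [::] ->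
     all [in bridges] (path_edges x p) ->
     exists2 e, e \in path_edges x p &
       {in path_edges x p, forall f, col f = col e -> f = e}) ->
  cf_colorable G k.
Proof.
move=> conn c10 col0 colB.
have [T /minsetP[spT minT] sTE] := @minset_exists _ spanning _ (spanning_edges conn).
have cutT t : t \in T -> ~~ spanning (T :\ t).
  move=> tT; apply/negP=> sp; have /setP/(_ t) := minT _ sp (subsetDl _ _).
  by rewrite !inE eqxx tT.
have sBT : bridges \subset T.
  apply/subsetP=> e; rewrite inE => /andP[eE]; apply: contraNT => eT.
  apply: sub_spanning spT; apply/subsetP=> f fT; rewrite !inE (subsetP sTE) // andbT.
  by apply: contraNneq eT => <-.
pose c := [ffun e : edge G => if val e \in bridges then col (val e)
                              else if val e \in T then c1 else c0].
exists c => x y xy.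
have /connectP[p0 p0P yE] : connect (restr T) x y by have /forallP/(_ x)/forallP/(_ y) := spT.
case: (shortenP p0P) yE => p pT p_uniq _ yE {p0 p0P}.
have := pT; rewrite restr_pathE => /andP[pP /allP pET].
have pN : p != [::] by apply: contraNneq xy => p0; rewrite yE p0.
(* [p] lies in [T], where only a bridge can be coloured [c0]; so [g] is alone in its colour. *)
have [/hasP[g gp /andP[gB /eqP g0]]|no0] :=
    boolP (has (fun g => (g \in bridges) && (col g == c0)) (path_edges x p)).
  exists p => //; apply: (@conflict_freeI _ _ c0 _ _ g) => // f fp.
  rewrite ffunE pET //; case: ifP => [fB|fB].
    by apply/eqP/eqP => [f0|->//]; apply: col0.
  by rewrite (negbTE c10); apply/esym/negbTE; apply: contraFneq fB => ->.
have [allB|] := boolP (all [in bridges] (path_edges x p)).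
  have [e ep e_uniq] := colB x p pP p_uniq pN allB.
  exists p => //; apply: (@conflict_freeI _ _ (col e) _ _ e) => // f fp.
  rewrite ffunE (allP allB _ fp).
  by apply/eqP/eqP => [|->//]; apply: e_uniq.
case/allPn=> t tp tB; have tT := pET _ tp; have tE := path_edges_edges pP tp.
have [p1 [v [p2 [pE tuv]]]] := path_edgesP tp; set u := last x p1 in tuv.
have [t1 t2] : t \notin path_edges x p1 /\ t \notin path_edges v p2.
  by rewrite tuv; apply: uniq_path_split; rewrite -pE.
have xu : connect (restr (T :\ t)) x u.
  apply/connectP; exists p1 => //; move: pT; rewrite pE cat_path !restr_pathE.
  case/andP=> /andP[p1P /allP p1T] _; rewrite p1P; apply/allP=> f fp.
  by rewrite !inE p1T // andbT; apply: contraNneq t1 => <-.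
have vy : connect (restr (T :\ t)) v y.
  apply/connectP; exists p2; last by rewrite yE pE last_cat.
  move: pT; rewrite pE cat_path /= => /and3P[_ _]; rewrite !restr_pathE.
  case/andP=> p2P /allP p2T; rewrite p2P; apply/allP=> f fp.
  by rewrite !inE p2T // andbT; apply: contraNneq t2 => <-.
have uvN : ~~ connect (restr (T :\ t)) u v.
  by apply: contra (cutT t tT); rewrite tuv; apply: spanningD1.
have uv_conn : connect (restr (edges G :\ t)) u v.
  move: tB; rewrite inE tE /= negbK => /forallP/(_ u)/forallP/(_ v); exact.
(* [t] is not a bridge, so some other edge of [G] leaves the component of [u] in [T :\ t]; such an
   edge is outside [T]. *)
have [[a b] /and3P[/= ab ua ubN]] : exists ab : G * G,
    [&& restr (edges G :\ t) ab.1 ab.2, connect (restr (T :\ t)) u ab.1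
      & ~~ connect (restr (T :\ t)) u ab.2].
  apply/existsP; apply: contraR uvN; rewrite negb_exists => /forallP nab.
  apply: connect_ind_closed uv_conn _ => // a b ab ua.
  by have := nab (a, b); rewrite /= ab ua /= negbK.
have /andP[adj_ab /setD1P[abt abE]] := ab.
have abT : [set a; b] \notin T.
  apply: contra ubN => abT; apply: connect_trans ua (connect1 _).
  by rewrite /restr adj_ab !inE abt.
have vb : connect (restr (T :\ t)) v b.
  have /forallP/(_ u)/forallP/(_ b)/connectD1-/(_ v) := spT.
  by rewrite -tuv (negbTE ubN).
have /connectP[pa0 pa0P aE] : connect (restr (T :\ t)) x a by apply: connect_trans xu ua.
have /connectP[pb0 pb0P yE'] : connect (restr (T :\ t)) b y.
  by apply: connect_trans vy; rewrite connect_restrC.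
case: (shortenP pa0P) aE => pa paP pa_uniq _ aE {pa0 pa0P}.
case: (shortenP pb0P) yE' => pb pbP pb_uniq _ yE' {pb0 pb0P}.
have conn_mem (z : G) q w : path (restr (T :\ t)) z q -> w \in z :: q ->
    connect (restr (T :\ t)) z w by move=> qP; apply: path_connect.
have pP' : path (@adj G) x (pa ++ b :: pb).
  rewrite cat_path /= -aE adj_ab /=.
  by move: paP pbP; rewrite !restr_pathE => /andP[-> _] /andP[-> _].
(* [pa] and [pb] stay in different components of [T :\ t]. *)
have p_uniq' : uniq (x :: pa ++ b :: pb).
  rewrite -cat_cons cat_uniq; apply/and3P; split=> //; apply/hasPn => w wb.
  apply/negP => wa; case/negP: ubN.
  apply: (@connect_trans _ _ w); last first.
    by rewrite connect_restrC; apply: conn_mem pbP wb.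
  apply: connect_trans (conn_mem _ _ _ paP wa).
  by rewrite connect_restrC.
exists (pa ++ b :: pb); first by split; rewrite // last_cat.
apply: (@conflict_freeI _ _ c0 _ _ [set a; b]) => // [|f fp].
  by rewrite path_edges_cat mem_cat /= -aE mem_head orbT.
rewrite ffunE; have [fB|fB] := boolP (val f \in bridges).
  have -> : (val f == [set a; b]) = false.
    by apply: contraNF abT => /eqP<-; rewrite (subsetP sBT).
  (* A bridge on the detour separates [x] from [y], so it is on [p] too, where [no0] excludes
     [c0]. *)
  apply/negbTE; apply: contraNN no0 => /eqP f0; apply/hasP; exists (val f).
    apply: contraTT isT => fNp.
    have := bridge_on_path conn fB pP' p_uniq' fp.
    by rewrite last_cat /= -yE' yE path_connectD1.
  by rewrite fB f0 eqxx.
(* [pa] and [pb] run inside [T], so [[set a; b]] is the only edge of the detour outside [T]. *)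
case: ifP => fT; last first.
  rewrite eqxx; move: fp; rewrite path_edges_cat mem_cat /= inE -aE.
  case/or3P=> [fp|/eqP->|fp]; last first.
  - by move: pbP; rewrite restr_pathE => /andP[_ /allP/(_ _ fp)]; rewrite !inE fT andbF.
  - by rewrite eqxx.
  - by move: paP; rewrite restr_pathE => /andP[_ /allP/(_ _ fp)]; rewrite !inE fT andbF.
rewrite (negbTE c10); apply/esym/negbTE; by apply: contraNneq abT => <-.
Qed.
End Bridges.

(** * Explicit colourings of the bridges *)

Lemma cf_colorable_few_bridges (G : sgraph) k :
  connected G -> (1 < k)%N -> (#|bridges G| <= k)%N -> cf_colorable G k.
Proof.
case: k => [|k] // conn k1 leBk.
have lt_ind e : e \in bridges G -> (index e (enum (bridges G)) < k.+1)%N.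
  by move=> eB; apply: leq_trans leBk; rewrite cardE index_mem mem_enum.
have inj : {in bridges G &, injective
    (fun e => inord (index e (enum (bridges G))) : 'I_k.+1)}.
  move=> e f eB fB /(congr1 val)/=; rewrite !inordK ?lt_ind // => eqi.
  by apply: (index_inj e _ _ eqi); rewrite mem_enum.
apply: (@cf_colorable_bridges G k.+1 ord0 ord_max
  (fun e => inord (index e (enum (bridges G))))) => //.
- by rewrite -val_eqE /=; lia.
- by move=> e f eB fB e0 f0; apply: inj => //; rewrite e0.
move=> x [|y p] // _ _ _ /allP pB; exists [set x; y]; first exact: mem_head.
by move=> f fp eqc; apply: inj => //; apply: pB => //; apply: mem_head.
Qed.

(* [e] and [f] get the same colour: a path made of these two
   edges only would use them consecutively, but they share no vertex. *)
Lemma cf_colorable_disjoint_bridges (G : sgraph) k e f :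
    connected G -> (2 < k)%N -> #|bridges G| = k.+1 ->
    e \in bridges G -> f \in bridges G -> [disjoint e & f] -> cf_colorable G k.
Proof.
case: k => [|k] // conn k2 cardB eB fB dis.
have eD : exists z, z \in e.
  have /edgesP[u [v [_ ->]]] : e \in edges G by move: eB; rewrite inE => /andP[].
  by exists u; apply: set21.
have ef : e != f.
  by apply: contraTneq dis => <-; case: eD => z ze; apply/pred0Pn; exists z; rewrite /= ze.
pose s := enum (bridges G :\ e :\ f).
have size_s : size s = k.
  have := cardsD1 e (bridges G); have := cardsD1 f (bridges G :\ e).
  by rewrite /s -cardE !in_setD1 eB fB (eq_sym f) ef cardB; lia.
have ind_s h : h \in bridges G -> h != e -> h != f -> (index h s < k)%N.
  by move=> hB he hf; rewrite -size_s index_mem mem_enum !in_setD1 hB he hf.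
have eNs : e \notin s by rewrite mem_enum !in_setD1 eqxx andbF.
have fNs : f \notin s by rewrite mem_enum !in_setD1 eqxx.
(* [index] of an absent element is the length: [e] and [f] share the last colour, and the other
   bridges get distinct smaller ones. *)
have ind_e : index e s = k by rewrite memNindex.
have ind_f : index f s = k by rewrite memNindex.
have ind_lt h : (index h s < k.+1)%N by rewrite ltnS -size_s index_size.
have col_inj h h' : h \in bridges G -> h' \in bridges G -> h != e -> h != f ->
    index h' s = index h s -> h' = h.
  move=> hB h'B he hf eqi; have lt_h := ind_s h hB he hf.
  have hs : h \in s by rewrite mem_enum !in_setD1 hB he hf.
  have h's : h' \in s by rewrite -index_mem eqi index_mem.
  exact: (index_inj e h's hs eqi).
apply: (@cf_colorable_bridges G k.+1 ord0 ord_max (fun h => inord (index h s))) => //.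
- by rewrite -val_eqE /=; lia.
- move=> h h' hB h'B /(congr1 val)/=; rewrite inordK // => h0.
  move=> /(congr1 val)/=; rewrite inordK // => h'0.
  apply/esym/col_inj => //; last by rewrite h0 h'0.
    by apply: contra_eq_neq h0 => ->; rewrite ind_e; lia.
  by apply: contra_eq_neq h0 => ->; rewrite ind_f; lia.
move=> x p pP p_uniq pN /allP pB.
have [/hasP[h hp /norP[he hf]]|] :=
    boolP (has (fun h => ~~ ((h == e) || (h == f))) (path_edges x p)).
  exists h => // h' h'p /(congr1 val)/=; rewrite !inordK //; apply: col_inj => //; exact: pB.
rewrite -all_predC => /allP p_ef.
(* Only [e] and [f] remain. A single edge is unique; two consecutive edges are distinct, so they
   would be [e] and [f] meeting at [y]. *)
case: p pN => [//|y [|z p]] _ in pP p_uniq pB p_ef *.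
  by exists [set x; y]; [exact: mem_head | move=> h; rewrite inE => /eqP->].
have := p_ef _ (mem_head _ _); rewrite /= negbK => xy_ef.
have : [set y; z] \in path_edges x [:: y, z & p] by rewrite !inE eqxx orbT.
move/p_ef; rewrite /= negbK => yz_ef.
have xy_yz : [set x; y] != [set y; z].
  apply: contraL p_uniq => /eqP eqs; have := set21 x y.
  by rewrite eqs /= !inE orbA => ->.
have disP h : h \in e -> h \in f -> False.
  by move=> he hf; move/pred0P/(_ h): dis; rewrite /= he hf.
case/orP: xy_ef yz_ef xy_yz => /eqP xyE /orP[]/eqP yzE; rewrite xyE yzE ?eqxx // => _.
  by case: (disP y); rewrite -?xyE -?yzE !inE eqxx ?orbT.
by case: (disP y); rewrite -?xyE -?yzE !inE eqxx ?orbT.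
Qed.

(** Pairwise meeting pairs form a star or a triangle, and a triangle has only three pairs. *)
Lemma intersecting_pairs (T : finType) (B : {set {set T}}) :
  (3 < #|B|)%N -> {in B, forall e : {set T}, #|e| = 2} ->
  {in B &, forall e f : {set T}, ~~ [disjoint e & f]} ->
  exists v, {in B, forall e : {set T}, v \in e}.
Proof.
move=> B4 B2 Bint.
have pair_eq (e : {set T}) u v : #|e| = 2 -> u \in e -> v \in e -> u != v -> e = [set u; v].
  move=> e2 ue ve uv; apply/esym/eqP; rewrite eqEcard subUset !sub1set ue ve /=.
  by rewrite e2 cards2 uv.
have meet e f : e \in B -> f \in B -> exists2 z, z \in e & z \in f.
  by move=> eB fB; have /pred0Pn[z /andP[/= ze zf]] := Bint _ _ eB fB; exists z.
apply: contrapT => noV.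
have avoid v : exists2 e, e \in B & v \notin e.
  apply: contrapT => nov; apply: noV; exists v => e eB.
  by apply: contrapT => /negP ve; apply: nov; exists e.
have [e1 e1B] : exists e, e \in B by apply/set0Pn; rewrite -card_gt0; lia.
have /eqP/cards2P[a [b [ab e1E]]] := B2 _ e1B.
have [e2 e2B ae2] := avoid a; have [e3 e3B be3] := avoid b.
have be2 : b \in e2.
  have [z] := meet _ _ e1B e2B; rewrite e1E !inE => /orP[]/eqP-> //.
  by rewrite (negbTE ae2).
have ae3 : a \in e3.
  have [z] := meet _ _ e1B e3B; rewrite e1E !inE => /orP[]/eqP-> //.
  by rewrite (negbTE be3).
have [c ce2 ce3] := meet _ _ e2B e3B.
have ac : a != c by apply: contraNneq ae2 => ->.
have bc : b != c by apply: contraNneq be3 => ->.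
have e2E := pair_eq _ _ _ (B2 _ e2B) be2 ce2 bc.
have e3E := pair_eq _ _ _ (B2 _ e3B) ae3 ce3 ac.
(* A pair meeting all three sides of the triangle [a], [b], [c] consists of two of its corners. *)
have sB : B \subset [set e1; e2; e3].
  apply/subsetP=> e eB; rewrite !inE.
  have [z1 z1e] := meet _ _ eB e1B; have [z2 z2e] := meet _ _ eB e2B.
  have [z3 z3e] := meet _ _ eB e3B.
  rewrite e1E e2E e3E !inE => /orP[]/eqP zE3 /orP[]/eqP zE2 /orP[]/eqP zE1;
    subst z1 z2 z3; have e2c := B2 _ eB;
    first [ by rewrite (pair_eq e a b) ?eqxx | by rewrite (pair_eq e b c) ?eqxx ?orbT
             | by rewrite (pair_eq e a c) ?eqxx ?orbT ].
have := subset_leq_card sB; have := cards2 e1 e2; have := cardsU1 e3 [set e1; e2].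
by rewrite [e3 |: _]setUC; case: (_ \notin _); case: (_ != _) => -> ->; lia.
Qed.

(** * Arithmetic of the extremal problem *)

(* [f] and [W] are the number of free nodes and the sum of their sizes minus
   one; [a] and [Sg] are the number of tight nodes on one side of the tree and
   the number of bridge ends attached to them.  [X] and [Y] are the degree sums
   of the cheapest [j] tight and [4 - j] free representatives. *)
Definition cheap_choice (D f W a Sg : nat) : Prop :=
  forall j, j <= 4 -> j <= a -> 4 - j <= f -> exists X Y,
    [/\ D <= X + Y, a * X <= j * Sg /\ X + (a - j) <= Sg, X <= j * Sg,
        f * Y <= (4 - j) * W /\ Y <= W & Y <= (4 - j) * W].

(** [bound_m1], [bound_m2] and [bound_m3] contradict [choice_bound] with one, two and three free
    representatives; [u] counts the tight nodes, of which [bound_m3] has two. *)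
Lemma bound_m1 k n f u : 7 <= k -> k * k + 7 * k + 19 <= n ->
  5 <= u <= 6 -> k + 2 <= f + u -> f <= k + 1 ->
  f * ((k + 2) * (f + u - 1) + (4 * k + 7)) + (k + 2) * 1 * n
    < f * (4 * n) + (k + 2) * 1 * (f + u).
Proof.
move=> k7 nk u56 fu fk.
have [t kE] : exists t, k = 7 + t by exists (k - 7); lia.
have [s nE] : exists s, n = k * k + 7 * k + 19 + s by exists (n - (k * k + 7 * k + 19)); lia.
rewrite nE kE.
have uE : u = 5 \/ u = 6 by lia.
have fE : f = t + 3 \/ f = t + 4 \/ f = t + 5 \/ f = t + 6 \/ f = t + 7 \/ f = t + 8 by lia.
case: uE => uE; case: fE => [|[|[|[|[|]]]]] fE; rewrite uE fE in fu fk *; try lia; nia.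
Qed.

Lemma quadratic_le_order k n : 10 <= k ->
  k ^ 3 + 5 * k ^ 2 + 4 * k + 2 * n < n * k + 3 -> k * k + 7 * k + 19 <= n.
Proof.
move=> k10; rewrite !expnS !expn0 !muln1 leqNgt => lt_n; apply/negP => n_lt.
have [t kE] : exists t, k = t + 2 by exists (k - 2); lia.
have : n * t <= (k * k + 7 * k + 18) * t by rewrite leq_mul2r; lia.
rewrite kE in k10 lt_n n_lt *; lia.
Qed.

(** From [k = 11] on, the term 33/(k-2) of the hypothesis is dropped; for [k = 10] it is kept, 188 +
    33/8 rounding up to 193. *)
Definition large_order k n : Prop :=
  (k = 7 /\ 286 <= n) \/ (k = 8 /\ 207 <= n) \/ (k = 9 /\ 190 <= n) \/
  (k = 10 /\ 193 <= n) \/ (11 <= k /\ k * k + 7 * k + 19 <= n).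

Lemma bound_m2 k n f u :
  large_order k n ->
  3 <= u <= 4 -> k + 2 <= f + u -> f <= k + 1 ->
  f * ((k + 2) * (f + u - 1) + (4 * k + 7)) + (k + 2) * 2 * n
    < f * (4 * n) + (k + 2) * 2 * (f + u).
Proof.
move=> kn u34 fu fk.
have uE : u = 3 \/ u = 4 by lia.
have fE : f = k - 2 \/ f = k - 1 \/ f = k \/ f = k + 1 by lia.
case: kn => [[kE nk]|[[kE nk]|[[kE nk]|[[kE nk]|[k11 nk]]]]].
1-4: by rewrite kE in fE fu fk *; case: uE => uE;
     case: fE => [|[|[|]]] fE; rewrite uE fE in fu fk *; lia.
have [t kE] : exists t, k = 11 + t by exists (k - 11); lia.
have [s nE] : exists s, n = k * k + 7 * k + 19 + s by exists (n - (k * k + 7 * k + 19)); lia.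
have {}fE : f = t + 9 \/ f = t + 10 \/ f = t + 11 \/ f = t + 12 by lia.
rewrite nE kE.
by case: uE => uE; case: fE => [|[|[|]]] fE; rewrite uE fE in fu fk *; try lia; nia.
Qed.

(** One of two tight nodes can be chosen with at most half of [f + 2] bridge ends, rounded down. *)
Lemma bound_m3 k n f :
  large_order k n ->
  k <= f -> f <= k + 1 ->
  f * ((k + 2) * (f + 2)./2 + (4 * k + 7)) + (k + 2) * 3 * n
    < f * (4 * n) + (k + 2) * 3 * (f + 2).
Proof.
move=> kn fk kf.
have fE : f = k \/ f = k + 1 by lia.
have [h hE hf] : exists2 h, h = (f + 2)./2 & 2 * h <= f + 2 by exists (f + 2)./2; lia.
rewrite -hE.
case: kn => [[kE nk]|[[kE nk]|[[kE nk]|[[kE nk]|[k11 nk]]]]].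
1-4: by rewrite kE in fE *; case: fE => fE; rewrite fE in hf *; lia.
have [t kE] : exists t, k = 11 + t by exists (k - 11); lia.
have [s nE] : exists s, n = k * k + 7 * k + 19 + s by exists (n - (k * k + 7 * k + 19)); lia.
suff : f * ((k + 2) * (2 * h) + 2 * (4 * k + 7)) + (k + 2) * 6 * n
    < f * (8 * n) + (k + 2) * 6 * (f + 2) by nia.
have : f * ((k + 2) * (2 * h)) <= f * ((k + 2) * (f + 2)) by rewrite !leq_mul.
suff : f * ((k + 2) * (f + 2) + 2 * (4 * k + 7)) + (k + 2) * 6 * n
    < f * (8 * n) + (k + 2) * 6 * (f + 2) by nia.
rewrite {hE hf} nE kE in fE *.
by case: fE => fE; rewrite fE in fk kf *; nia.
Qed.

(* [k^3 + 5k^2 + 4k - 3 < n(k - 2)] is the last hypothesis of case (v) cleared of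
   denominators; here it is used in full, for one tight node with [k + 1]
   bridges and [k + 1] free nodes. *)
Lemma bound_m3_exact k n : 7 <= k ->
  k ^ 3 + 5 * k ^ 2 + 4 * k + 2 * n < n * k + 3 ->
  (k + 1) * ((k + 2) * (k + 1) + (4 * k + 7)) + (k + 2) * 3 * n
    < (k + 1) * (4 * n) + (k + 2) * 3 * (k + 1 + 1).
Proof. rewrite !expnS !expn0 !muln1; nia. Qed.

(** * Contradictions from the degree-sum inequalities *)

Section Numeric.
Variables (D f W a0 S0 a1 S1 n : nat).
(** There are [f + a0 + a1] nodes and fewer bridges. [lt_S0] holds as a bridge has one end on each
    side, [le_S] as every free node also takes a bridge end, [W_ge] as a free node has at least
    three vertices. *)
Hypotheses (le_a : a1 <= a0) (choice0 : cheap_choice D f W a0 S0)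
  (choice1 : cheap_choice D f W a1 S1) (lt_S0 : S0 < f + a0 + a1)
  (le_S : S0 + S1 + f + 2 <= 2 * (f + a0 + a1))
  (le_W : W + f + a0 + a1 <= n) (W_ge : 2 * f <= W).

(** Any choice of four nodes is contradictory. If there is none, [a0 <= 3 - f] and there are at most
    [6 - f] nodes; the exception has three tight nodes on each side. *)
Lemma few_nodes_n : 6 <= f + a0 + a1 -> n <= D -> f = 0 /\ f + a0 + a1 = 6.
Proof.
move=> s6 nD; have [f4|f3] := leqP 4 f.
  have [X [Y [? [_ _] ? [_ ?] _]]] := choice0 (leq0n 4) (leq0n _) f4; lia.
have [j_a|a_j] := leqP (4 - f) a0; last lia.
have [||X [Y [? [_ ?] ? [_ ?] ?]]] := choice0 _ j_a; try lia.
Qed.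

Lemma few_nodes_n1 : 7 <= f + a0 + a1 -> 11 <= n -> n <= D.+1 -> False.
Proof.
move=> s7 n11 nD; have [f4|f3] := leqP 4 f.
  have [X [Y [? [_ _] ? [_ ?] _]]] := choice0 (leq0n 4) (leq0n _) f4; lia.
have [j_a|a_j] := leqP (4 - f) a0; last lia.
have [||X [Y [? [_ ?] ? [_ ?] ?]]] := choice0 _ j_a; try lia.
have [j_a1|a_j1] := leqP (4 - f) a1; last lia.
(* The first choice leaves only [a0 = 4 - f], hence [a1 = a0] here; if [f = 1], then [S0 + S1 <= 11]
   makes the two choices together too cheap. *)
have [||X' [Y' [? [_ ?] ? [_ ?] ?]]] := choice1 _ j_a1; lia.
Qed.

(** Four tight nodes are taken. As [S0 < f + 2 * a0], averaging gives [f + 7]; the other bound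
    leaves one bridge end to each unchosen node. *)
Lemma choice4_le : 4 <= a0 -> D <= f + 7 /\ D <= f + a1 + 3.
Proof.
move=> a4; have [//|X [Y [? [? ?] ? _ ?]]] := choice0 (leqnn 4) a4.
have : X <= f + 7 by nia.
lia.
Qed.

Lemma few_nodes_half : 8 <= f + a0 + a1 -> 17 <= n -> n + 5 <= 2 * D -> False.
Proof.
move=> s8 n17 nD; have [f8|f7] := leqP 8 f.
  have f4 : 4 <= f by lia.
  have [X [Y [? [_ _] ? [? ?] _]]] := choice0 (leq0n 4) (leq0n _) f4.
  have : 8 * Y <= 4 * W by nia.
  lia.
have [a4|a3] := leqP 4 a0; first by have := choice4_le a4; lia.
(* [a0] tight nodes are taken, but only one if [a0 = 2] and [a1 = 0]. When [a0 = a1], the choices on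
   both sides are added so that [le_S] applies. *)
have fE : f = 2 \/ f = 3 \/ f = 4 \/ f = 5 \/ f = 6 \/ f = 7 by lia.
have [u6|u6] := eqVneq (a0 + a1) 6.
  have j0 : 3 <= a0 by lia. have j1 : 3 <= a1 by lia.
  have [||X [Y [? [_ ?] _ [fY _] _]]] := choice0 _ j0; [lia | lia |].
  have [||X' [Y' [? [_ ?] _ [fY' _] _]]] := choice1 _ j1; [lia | lia |].
  by case: fE => [|[|[|[|[|]]]]] fE; rewrite fE in fY fY'; lia.
have [u5|u5] := eqVneq (a0 + a1) 5.
  have j0 : 3 <= a0 by lia.
  have [||X [Y [? [_ ?] _ [fY _] _]]] := choice0 _ j0; [lia | lia |].
  by case: fE => [|[|[|[|[|]]]]] fE; rewrite fE in fY; lia.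
have [a03|a03] := eqVneq a0 3.
  have j0 : 3 <= a0 by lia.
  have [||X [Y [? [_ ?] _ [fY _] _]]] := choice0 _ j0; [lia | lia |].
  by case: fE => [|[|[|[|[|]]]]] fE; rewrite fE in fY; lia.
have [u4|u4] := eqVneq (a0 + a1) 4.
  have j0 : 2 <= a0 by lia. have j1 : 2 <= a1 by lia.
  have [||X [Y [? [_ ?] _ [fY _] _]]] := choice0 _ j0; [lia | lia |].
  have [||X' [Y' [? [_ ?] _ [fY' _] _]]] := choice1 _ j1; [lia | lia |].
  by case: fE => [|[|[|[|[|]]]]] fE; rewrite fE in fY fY'; lia.
have [u3|u3] := eqVneq (a0 + a1) 3.
  have j0 : 2 <= a0 by lia.
  have [||X [Y [? [_ ?] _ [fY _] _]]] := choice0 _ j0; [lia | lia |].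
  by case: fE => [|[|[|[|[|]]]]] fE; rewrite fE in fY; lia.
have j0 : 1 <= a0 by lia.
have [||X [Y [? [aX ?] _ [fY _] _]]] := choice0 _ j0; [lia | lia |].
have [u1|u1] := eqVneq (a0 + a1) 1.
  by case: fE => [|[|[|[|[|]]]]] fE; rewrite fE in fY; lia.
have [a02|a02] := eqVneq a0 2.
  by rewrite a02 in aX; case: fE => [|[|[|[|[|]]]]] fE; rewrite fE in fY; lia.
have j1 : 1 <= a1 by lia.
have [||X' [Y' [? [_ ?] _ [fY' _] _]]] := choice1 _ j1; [lia | lia |].
by case: fE => [|[|[|[|[|]]]]] fE; rewrite fE in fY fY'; lia.
Qed.

(** Multiplying by [f] allows [Y] to be replaced through [f * Y <= m * W]; [le_W] then eliminates
    [W]. *)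
Lemma choice_bound k m c : 0 < f -> 4 * n <= (k + 2) * D + (4 * k + 7) ->
  (exists X Y, [/\ D <= X + Y, X <= c & f * Y <= m * W]) ->
  f * (4 * n) + (k + 2) * m * (f + a0 + a1)
    <= f * ((k + 2) * c + (4 * k + 7)) + (k + 2) * m * n.
Proof.
move=> f0 nD [X [Y [DXY Xc fY]]].
have le1 : f * (4 * n) <= f * ((k + 2) * (c + Y) + (4 * k + 7)).
  rewrite leq_mul2l; apply/orP; right; apply: leq_trans nD _.
  by rewrite leq_add2r leq_mul2l; apply/orP; right; lia.
have : (k + 2) * (f * Y) <= (k + 2) * (m * W) by rewrite leq_mul2l fY orbT.
have : (k + 2) * m * (W + f + a0 + a1) <= (k + 2) * m * n by rewrite leq_mul2l le_W orbT.
move: le1; nia.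
Qed.

Lemma few_nodes_large k : 7 <= k -> k + 2 <= f + a0 + a1 ->
  4 * n <= (k + 2) * D + (4 * k + 7) ->
  (k = 7 -> 286 <= n) -> (k = 8 -> 207 <= n) -> (k = 9 -> 190 <= n) ->
  (10 <= k -> k ^ 3 + 5 * k ^ 2 + 4 * k + 2 * n < n * k + 3) -> False.
Proof.
move=> k7 sk nD n7 n8 n9 n10.
have {n7 n8 n9 n10} [large exact] : large_order k n /\
    k ^ 3 + 5 * k ^ 2 + 4 * k + 2 * n < n * k + 3.
  have [kE|[kE|[kE|k10]]] : k = 7 \/ k = 8 \/ k = 9 \/ 10 <= k by lia.
  - by rewrite /large_order; move: (n7 kE); rewrite kE; split; lia.
  - by rewrite /large_order; move: (n8 kE); rewrite kE; split; lia.
  - by rewrite /large_order; move: (n9 kE); rewrite kE; split; lia.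
  split; last exact: n10.
  have := quadratic_le_order k10 (n10 k10); rewrite /large_order; have := n10 k10.
  have [->|k11] : k = 10 \/ 11 <= k by lia.
    by lia.
  by move=> _ nk; do 4!right.
have nk : k * k + 7 * k + 19 <= n.
  by case: large => [|[|[|[|]]]] [kE ?] //; rewrite kE; lia.
(* Four free nodes give [(k + 2) * D <= 4 * W <= 4 * n - 4 * k - 8], one less than the hypothesis
   requires. *)
have [fk|fk] := leqP (k + 2) f.
  have f4 : 4 <= f by lia.
  have [X [Y [? [_ _] ? [fY _] _]]] := choice0 (leq0n 4) (leq0n _) f4.
  have : (k + 2) * D <= (k + 2) * Y by rewrite leq_mul2l; lia.
  have : (k + 2) * Y <= f * Y by rewrite leq_mul2r fk orbT.
  lia.
have [a4|a3] := leqP 4 a0.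
  have [le_D _] := choice4_le a4.
  have : (k + 2) * D <= (k + 2) * (k + 8) by rewrite leq_mul2l; lia.
  lia.
have f0 : 0 < f by lia.
have bound m c := @choice_bound k m c f0 nD.
have [u5|u4] := leqP 5 (a0 + a1).
  have j0 : 3 <= a0 by lia.
  have [||X [Y [? [_ ?] _ [fY _] _]]] := choice0 _ j0; [lia | lia |].
  have /bound : exists X Y, [/\ D <= X + Y, X <= f + (a0 + a1) - 1 & f * Y <= 1 * W].
    by exists X, Y; split=> //; lia.
  rewrite -addnA leqNgt bound_m1 //; lia.
have [u3|u2] := leqP 3 (a0 + a1).
  have j0 : 2 <= a0 by lia.
  have [||X [Y [? [_ ?] _ [fY _] _]]] := choice0 _ j0; [lia | lia |].
  have /bound : exists X Y, [/\ D <= X + Y, X <= f + (a0 + a1) - 1 & f * Y <= 2 * W].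
    by exists X, Y; split=> //; lia.
  rewrite -addnA leqNgt bound_m2 //; lia.
have j0 : 1 <= a0 by lia.
have [||X [Y [? [aX ?] _ [fY _] _]]] := choice0 _ j0; [lia | lia |].
have [u1|u1] := eqVneq (a0 + a1) 1.
  have fE : f = k + 1 by lia.
  have /bound : exists X Y, [/\ D <= X + Y, X <= k + 1 & f * Y <= 3 * W].
    by exists X, Y; split=> //; lia.
  by rewrite -addnA u1 leqNgt fE bound_m3_exact.
have {}u2 : a0 + a1 = 2 by lia.
(* Two tight nodes on one side are averaged; on opposite sides, the one with fewer bridge ends is
   taken, as [S0 + S1 <= f + 2]. *)
have : exists X Y, [/\ D <= X + Y, X <= (f + 2)./2 & f * Y <= 3 * W].
  have [a02|a02] := eqVneq a0 2.
    by rewrite a02 in aX; exists X, Y; split=> //; lia.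
  have j1 : 1 <= a1 by lia.
  have [||X' [Y' [? [_ ?] _ [fY' _] _]]] := choice1 _ j1; [lia | lia |].
  have [le_S01|lt_S10] := leqP S0 S1; first by exists X, Y; split=> //; lia.
  by exists X', Y'; split=> //; lia.
by move/bound; rewrite -addnA u2 leqNgt bound_m3 //; lia.
Qed.
End Numeric.

(** * The tree of 2-edge-connected components *)

(* Forgetting [e] identifies the two members of the family that differ only in
   [e], and keeps the hypothesis for the other elements of [B]. *)
Lemma card_separating_family (T : finType) (B : {set T}) (N : {set {set T}}) :
  N != set0 ->
  {in B, forall e : T, exists nu : {set T}, [/\ e \notin nu, nu \in N & e |: nu \in N]} ->
  (#|B| < #|N|)%N.
Proof.
elim: {B}_.+1 {-2}B (ltnSn #|B|) N => // m IH B leBm N N0 sep.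
have [->|[e eB]] := set_0Vmem B; first by rewrite cards0 card_gt0.
have cardB := cardsD1 e B; rewrite eB in cardB.
pose N' : {set {set T}} := [set nu :\ e | nu in N].
have ltBN' : (#|B :\ e| < #|N'|)%N.
  apply: IH; first lia.
    by have [nu nuN] := set0Pn _ N0; apply/set0Pn; exists (nu :\ e); apply: imset_f.
  move=> f /setD1P[fe fB]; have [nu [fnu nuN fnuN]] := sep f fB.
  exists (nu :\ e); split; [by rewrite !inE (negbTE fnu) andbF | exact: imset_f |].
  apply/imsetP; exists (f |: nu) => //; apply/setP=> g; rewrite !inE.
  by case: eqVneq => [->|_] //=; case: eqVneq => [ge|_] //=; move: fe; rewrite ge eqxx.
have [nu [enu nuN enuN]] := sep e eB.
have sN' : N' \subset [set nu :\ e | nu in N :\ nu].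
  apply/subsetP=> _ /imsetP[mu muN ->]; have [->|mu_nu] := eqVneq mu nu.
    apply/imsetP; exists (e |: nu); last first.
      rewrite setU1K //; apply/setP=> g; rewrite !inE.
      by case: eqVneq => // ->; rewrite (negbTE enu).
    rewrite !inE enuN andbT; apply: contraNneq enu => <-; exact: setU11.
  by apply: imset_f; rewrite !inE mu_nu.
have leN' : (#|N'| <= #|N :\ nu|)%N.
  exact: leq_trans (subset_leq_card sN') (leq_imset_card _ _).
rewrite cardB (cardsD1 nu N) nuN ltn_add2l; exact: leq_trans ltBN' leN'.
Qed.

(** Removing a heaviest element never raises the average. *)
Lemma exists_small_subset (T : finType) (A : {set T}) (w : T -> nat) j :
  (j <= #|A|)%N ->
  exists J : {set T}, [/\ J \subset A, #|J| = j
    & (#|A| * \sum_(x in J) w x <= j * \sum_(x in A) w x)%N].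
Proof.
elim: {A}_.+1 {-2}A (ltnSn #|A|) => // m IH A leAm.
rewrite leq_eqVlt => /orP[/eqP->|ltjA]; first by exists A.
have [a aA] : exists a, a \in A by apply/set0Pn; rewrite -card_gt0; lia.
case: (@arg_maxnP _ a [in A] w aA) => b /= bA b_max.
have cardA := cardsD1 b A; rewrite bA in cardA.
have [||J [sJ cardJ leJ]] := IH (A :\ b); [lia | lia |].
exists J; split=> //; first by apply: subset_trans sJ (subsetDl _ _).
have leA : (\sum_(x in A) w x <= #|A| * w b)%N.
  by rewrite -sum_nat_const; apply: leq_sum => x /b_max.
rewrite (big_setD1 b bA) /= in leA *.
have [A0|A0] := posnP #|A :\ b|.
  have J0 : J = set0 by apply: cards0_eq; lia.
  by rewrite J0 big_set0 muln0.
move: (\sum_(x in J) w x) (\sum_(x in A :\ b) w x) leA leJ => X Y leA leJ.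
rewrite -(leq_pmul2l A0).
have : (#|A :\ b|.+1 * (#|A :\ b| * X) <= #|A :\ b|.+1 * (j * Y))%N by rewrite leq_pmul2l.
have : (j * Y <= j * (#|A :\ b| * w b))%N by rewrite leq_mul2l; lia.
by rewrite cardA; nia.
Qed.

(** * Components as sets of separating bridges *)

Section Nodes.
Variables (G : sgraph) (r : G).
Hypothesis conn : connected G.
Implicit Types (x y z : G) (e : {set G}) (nu : {set {set G}}).

(* A 2-edge-connected component is encoded by the set of bridges separating it
   from the root [r]; the parity of the size of this set is a proper
   2-colouring of the tree of components. *)
Definition sep_bridges x : {set {set G}} :=
  [set e in bridges G | ~~ connect (restr (edges G :\ e)) r x].

Definition nodes : {set {set {set G}}} := sep_bridges @: [set: G].
Definition node_size nu : nat := #|[set x | sep_bridges x == nu]|.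
Definition bdeg x : nat := #|[set e in bridges G | x \in e]|.
Definition node_bdeg nu : nat := \sum_(x | sep_bridges x == nu) bdeg x.

Lemma adj_edge x y : adj x y -> [set x; y] \in edges G.
Proof. by move=> xy; apply/edgesP; exists x, y. Qed.

Lemma restr_D1 e x y : adj x y -> [set x; y] != e -> restr (edges G :\ e) x y.
Proof. by move=> xy xye; rewrite /restr xy !inE xye adj_edge. Qed.

Lemma connect_edge e x y z : adj x y -> [set x; y] != e ->
  connect (restr (edges G :\ e)) z x = connect (restr (edges G :\ e)) z y.
Proof.
move=> xy xye; apply: same_connect_r; first exact: connect_restrC.
exact/connect1/restr_D1.
Qed.

Lemma sep_bridges_nonbridge x y :
  adj x y -> [set x; y] \notin bridges G -> sep_bridges x = sep_bridges y.
Proof.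
move=> xy nB; apply/setP=> e; rewrite !in_set.
case eB: (e \in edges G) => //=; case sp: (spanning _) => //=.
rewrite (@connect_edge e x y) //; apply: contraNneq nB => ->.
by rewrite inE eB sp.
Qed.

Lemma sep_bridgesD1 x y : adj x y ->
  sep_bridges x :\ [set x; y] = sep_bridges y :\ [set x; y].
Proof.
move=> xy; apply/setP=> e; rewrite !in_setD1; case: eqVneq => //= nxy.
by rewrite /sep_bridges !in_set (@connect_edge e x y) // eq_sym.
Qed.

(** Without the bridge, [r] still reaches one of its ends by [connectD1], but not both, or the
    bridge could be spared. *)
Lemma mem_sep_bridges x y : adj x y -> [set x; y] \in bridges G ->
  ([set x; y] \in sep_bridges x) = ([set x; y] \notin sep_bridges y).
Proof.
move=> xy B; rewrite /sep_bridges ![in LHS]in_set ![in RHS]in_set.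
have := B; rewrite in_set => /andP[eE nsp]; rewrite eE nsp /= negbK.
have := @connectD1 _ (edges G) x y r.
have -> : connect (restr (edges G)) x r.
  have /forallP/(_ x)/forallP/(_ r) := spanning_edges conn; exact.
move=> /(_ isT); rewrite ![connect _ _ r]connect_restrC.
case rx: (connect _ r x); case ry: (connect _ r y) => //= _.
case/negP: nsp; apply: spanningD1; first exact: spanning_edges.
by apply: connect_trans ry; rewrite connect_restrC.
Qed.

Lemma odd_sep_bridges x y : adj x y -> [set x; y] \in bridges G ->
  odd #|sep_bridges x| != odd #|sep_bridges y|.
Proof.
move=> xy B; rewrite (cardsD1 [set x; y] (sep_bridges x)).
rewrite (cardsD1 [set x; y] (sep_bridges y)) sep_bridgesD1 // mem_sep_bridges //.
by rewrite !oddD !oddb; case: (_ \in _); case: (odd _).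
Qed.

(** The ends of a bridge give two nodes differing in that bridge only, as [card_separating_family]
    requires. *)
Lemma card_bridges_nodes : (#|bridges G| < #|nodes|)%N.
Proof.
apply: card_separating_family => [|e eB].
  by apply/set0Pn; exists (sep_bridges r); apply: imset_f.
have /edgesP[x [y [xy eE]]] : e \in edges G by move: eB; rewrite inE => /andP[].
wlog xe : x y xy eE / e \in sep_bridges x => [th|].
  have [xe|] := boolP (e \in sep_bridges x); first exact: th xy eE xe.
  rewrite eE mem_sep_bridges -?eE // negbK => ey.
  by apply: (th y x _ _ ey); rewrite ?(adj_sym y) ?(setUC [set y]).
have ye : e \notin sep_bridges y by rewrite eE -mem_sep_bridges -?eE.
exists (sep_bridges y); split; rewrite ?imset_f //.
suff -> : e |: sep_bridges y = sep_bridges x by apply: imset_f.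
rewrite -(setD1K xe) eE sep_bridgesD1 // -eE; congr (_ |: _).
by apply/setP=> f; rewrite in_setD1; case: eqVneq => // ->; rewrite (negbTE ye).
Qed.

(** The ends of a bridge have opposite parities, so each bridge is counted at most once. *)
Lemma sum_bdeg_class (P : pred G) b :
  (forall x, P x -> odd #|sep_bridges x| = b) ->
  (\sum_(x | P x) bdeg x <= #|bridges G|)%N.
Proof.
move=> Pb.
under eq_bigr => x _ do rewrite /bdeg -sum1dep_card.
rewrite (exchange_big_dep (mem (bridges G))) /=; last by move=> x e _ /andP[].
rewrite -sum1_card; apply: leq_sum => e eB.
have /edgesP[u [v [uv eE]]] : e \in edges G by move: eB; rewrite inE => /andP[].
rewrite sum1dep_card eB /=; apply/card_le1_eqP => x y; rewrite !inE.
move=> /andP[/Pb xb xe] /andP[/Pb yb ye]; rewrite eE in eB xe ye.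
have := odd_sep_bridges uv eB; move: xe ye; rewrite !inE.
by case/orP=> /eqP xE /orP[]/eqP yE; rewrite -?xE -?yE ?xb ?yb ?eqxx // xE yE.
Qed.

(** Neighbours along non-bridges lie in the component of [x], which also contains [x] itself, whence
    the strict inequality. *)
Lemma deg_le x : (deg x < node_size (sep_bridges x) + bdeg x)%N.
Proof.
pose A := [set y in [set y | adj x y] | [set x; y] \in bridges G].
have le1 : (#|A| <= bdeg x)%N.
  have <- : #|[set [set x; y] | y in A]| = #|A|; last first.
    apply/subset_leq_card/subsetP=> e /imsetP[y yA ->].
    by have /setIdP[_ yB] := yA; apply/setIdP; rewrite set21.
  apply: card_in_imset => y z; case/setIdP; rewrite inE => xy _ _ /setP/(_ y).
  rewrite !inE eqxx orbT => /esym/orP[]/eqP // yx.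
  by move: xy; rewrite yx adj_irrefl.
have sub : x |: ([set y | adj x y] :\: A) \subset [set y | sep_bridges y == sep_bridges x].
  apply/subsetP=> y /setU1P[->|/setDP[]]; rewrite inE // => xy yA.
  rewrite inE; apply/eqP/esym/sep_bridges_nonbridge => //.
  by apply: contra yA => yB; apply/setIdP; rewrite inE.
have := subset_leq_card sub; rewrite cardsU1 !inE adj_irrefl andbF /=.
have := cardsID A [set y | adj x y]; have := subset_leq_card (subsetIr [set y | adj x y] A).
rewrite /deg /node_size; lia.
Qed.

Lemma sum_nodes (M : {set {set {set G}}}) (F : G -> nat) :
  \sum_(nu in M) \sum_(x | sep_bridges x == nu) F x
    = \sum_(x | sep_bridges x \in M) F x.
Proof.
rewrite [RHS](partition_big sep_bridges (mem M)) //=.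
apply: eq_bigr => nu nuM; apply: eq_bigl => x.
by case: eqVneq => [->|]; rewrite ?nuM ?andbF.
Qed.

Lemma mem_nodes x : sep_bridges x \in nodes.
Proof. exact: imset_f. Qed.

Lemma sum_node_size : \sum_(nu in nodes) node_size nu = #|G|.
Proof.
under eq_bigr => nu _ do rewrite /node_size -sum1dep_card.
by rewrite sum_nodes -sum1_card; apply: eq_bigl => x; rewrite mem_nodes.
Qed.

Lemma node_size_gt0 nu : nu \in nodes -> (0 < node_size nu)%N.
Proof. by case/imsetP=> x _ ->; apply/card_gt0P; exists x; rewrite inE. Qed.

Lemma restr_uniq_path E x y : connect (restr E) x y ->
  exists p, [/\ path (restr E) x p, uniq (x :: p) & last x p = y].
Proof.
case/connectP=> p0 p0P yE; case: (shortenP p0P) yE => p pP p_uniq _ ->.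
by exists p.
Qed.

(** The rest of the path never returns to [x]; if [[set x; z]] were a bridge, the path would end on
    the side of [z], away from [x]. *)
Lemma first_edge_nonbridge x z p :
  path (@adj G) x (z :: p) -> uniq (x :: z :: p) ->
  sep_bridges x = sep_bridges (last z p) -> [set x; z] \notin bridges G.
Proof.
move=> /= /andP[xz zP] /andP[xzp _] sep_eq; apply/negP => B.
have: [set x; z] \notin path_edges z p.
  by apply: contra xzp => /path_edges_sub/(_ (set21 _ _)).
move/(path_connectD1 zP) => con.
have : ([set x; z] \in sep_bridges z) = ([set x; z] \in sep_bridges (last z p)).
  by rewrite !in_set (same_connect_r (connect_restrC _) con).
by rewrite -sep_eq mem_sep_bridges //; case: (_ \in _).
Qed.

Lemma next_in_node E x y : connect (restr E) x y -> x != y ->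
  sep_bridges x = sep_bridges y ->
  exists z, [/\ restr E x z, [set x; z] \notin bridges G, z != x
              & sep_bridges z = sep_bridges x].
Proof.
move=> /restr_uniq_path[[|z p] [pP p_uniq yE]] xy; first by rewrite -yE /= eqxx in xy.
rewrite -yE /= => sep_eq; exists z.
have nB : [set x; z] \notin bridges G.
  apply: first_edge_nonbridge p_uniq sep_eq.
  by move: pP; rewrite restr_pathE => /andP[].
have /= /andP[xz _] := pP; have /andP[adj_xz _] := xz.
split=> //; last exact/esym/sep_bridges_nonbridge.
by apply: contraTneq adj_xz => ->; rewrite adj_irrefl.
Qed.

(* A component with two vertices would need a double edge. *)
Lemma node_size_neq2 nu : node_size nu != 2.
Proof.
apply/negP => /cards2P[x [y [xy nuE]]].
have in_nu z : (sep_bridges z == nu) = (z == x) || (z == y).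
  by have /setP/(_ z) := nuE; rewrite !inE.
have /eqP xnu : sep_bridges x == nu by rewrite in_nu eqxx.
have /eqP ynu : sep_bridges y == nu by rewrite in_nu eqxx orbT.
have con : connect (restr (edges G)) x y.
  by have /forallP/(_ x)/forallP/(_ y) := spanning_edges conn.
have [z [xz nB zx znu]] := next_in_node con xy (etrans xnu (esym ynu)).
have zy : z = y.
  by have := in_nu z; rewrite znu xnu eqxx (negbTE zx) /= => /esym/eqP.
(* [x] and [y] are joined by a non-bridge; after its deletion the same argument demands a second
   edge between them. *)
subst z; have con' : connect (restr (edges G :\ [set x; y])) x y.
  have /andP[_ xyE] := xz; move: nB; rewrite inE xyE /= negbK.
  by move=> /forallP/(_ x)/forallP/(_ y).
have [z [/andP[_ xz'] _ zx' znu']] := next_in_node con' xy (etrans xnu (esym ynu)).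
have := in_nu z; rewrite znu' xnu eqxx (negbTE zx') /= => /esym/eqP zy'.
by move: xz'; rewrite zy' !inE eqxx.
Qed.

Lemma bdeg_gt0 x y : [set x; y] \in bridges G -> (0 < bdeg x)%N.
Proof. by move=> B; apply/card_gt0P; exists [set x; y]; apply/setIdP; rewrite set21. Qed.

(** A component without bridge ends is closed under adjacency, hence is everything. *)
Lemma node_bdeg_gt0 nu : nu \in nodes -> (1 < #|nodes|)%N -> (0 < node_bdeg nu)%N.
Proof.
case/imsetP=> x0 _ ->; apply: contraTltn; rewrite leqn0 sum_nat_eq0 => /forallP nob.
have all_nu x : sep_bridges x == sep_bridges x0.
  have /forallP/(_ x0)/forallP/(_ x) := conn.
  move/(connect_ind_closed (A := fun x => sep_bridges x == sep_bridges x0)); apply=> //.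
  move=> a b ab anu; rewrite -(eqP anu) eq_sym; apply/eqP/sep_bridges_nonbridge => //.
  by apply/negP => /bdeg_gt0; have /implyP/(_ anu)/eqP-> := nob a.
rewrite -leqNgt -(cards1 (sep_bridges x0)); apply/subset_leq_card/subsetP.
by move=> _ /imsetP[x _ ->]; rewrite inE.
Qed.

(** Take a vertex with the fewest bridges, say [b]. For [q] vertices and [d] bridge ends,
    [q * b <= d]; so [b = 0] if [d < q], and [q - 1 + b <= d] otherwise. *)
Lemma exists_low_vertex nu : nu \in nodes ->
  exists x, [/\ sep_bridges x = nu, (node_bdeg nu < node_size nu)%N -> bdeg x = 0
              & (deg x <= if node_bdeg nu < node_size nu then (node_size nu).-1
                          else node_bdeg nu)%N].
Proof.
move=> nuN; have [x0 _ x0E] := imsetP nuN.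
have x0nu : sep_bridges x0 == nu by rewrite -x0E.
case: (@arg_minnP _ x0 (fun x => sep_bridges x == nu) bdeg x0nu) => x /eqP xnu x_min.
have bdegM : (node_size nu * bdeg x <= node_bdeg nu)%N.
  rewrite /node_size -sum1dep_card big_distrl /=; apply: leq_sum => y ynu.
  by rewrite mul1n x_min.
have := deg_le x; have := node_size_gt0 nuN; rewrite xnu => q0 dx.
exists x; split=> //; first by move=> lt; nia.
by case: ltnP => lt; nia.
Qed.

Definition node_weight nu : nat :=
  if (node_bdeg nu < node_size nu)%N then (node_size nu).-1 else node_bdeg nu.

(** Take the low vertex of each node. Two adjacent ones would be joined by a bridge, so both nodes
    would be tight and of opposite parities. *)
Lemma exists_independent (I : {set {set {set G}}}) b :
  I \subset nodes ->
  {in I, forall nu, (node_size nu <= node_bdeg nu)%N -> odd #|nu| = b} ->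
  exists S : {set G}, [/\ independent S, #|S| = #|I|
    & (\sum_(x in S) deg x <= \sum_(nu in I) node_weight nu)%N].
Proof.
move=> sI Ib.
have [rep repP] : {rep : {set {set G}} -> G & forall nu, nu \in nodes ->
    [/\ sep_bridges (rep nu) = nu, (node_bdeg nu < node_size nu)%N -> bdeg (rep nu) = 0
      & (deg (rep nu) <= node_weight nu)%N]}.
  apply: (@boolp.choice _ _ (fun nu x => nu \in nodes -> [/\ sep_bridges x = nu,
    (node_bdeg nu < node_size nu)%N -> bdeg x = 0 & (deg x <= node_weight nu)%N])) => nu.
  have [nuN|_] := boolP (nu \in nodes); last by exists r.
  by have [x] := exists_low_vertex nuN; exists x.
have repK nu : nu \in I -> sep_bridges (rep nu) = nu.
  by move/(subsetP sI)/repP => [].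
have rep_inj : {in I &, injective rep}.
  by move=> nu mu /repK nuK /repK muK eq_rep; rewrite -nuK eq_rep.
exists (rep @: I); split.
- apply/forall_inP => _ /imsetP[nu nuI ->]; apply/forall_inP => _ /imsetP[mu muI ->].
  apply/negP => adj_nm; have [_ nu0 _] := repP _ (subsetP sI _ nuI).
  have [_ mu0 _] := repP _ (subsetP sI _ muI).
  have [B|nB] := boolP ([set rep nu; rep mu] \in bridges G).
    have := odd_sep_bridges adj_nm B; rewrite !repK //.
    have nu_sat : (node_size nu <= node_bdeg nu)%N.
      by rewrite leqNgt; apply/negP => /nu0; have := bdeg_gt0 B; lia.
    have mu_sat : (node_size mu <= node_bdeg mu)%N.
      by rewrite leqNgt; apply/negP => /mu0; rewrite setUC in B; have := bdeg_gt0 B; lia.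
    by rewrite !Ib // eqxx.
  have := sep_bridges_nonbridge adj_nm nB; rewrite !repK // => eq_nm.
  by move: adj_nm; rewrite eq_nm adj_irrefl.
- exact: card_in_imset.
rewrite big_imset //=; apply: leq_sum => nu nuI.
by have [] := repP _ (subsetP sI _ nuI).
Qed.

(** The far ends of four bridges at [v] lie in distinct components of equal parity. Their degrees
    sum to at most the sizes of these components plus the number of bridges minus 4, and each other
    component has a vertex. *)
Lemma independent_star v : {in bridges G, forall e : {set G}, v \in e} ->
  (3 < #|bridges G|)%N ->
  exists S : {set G}, [/\ independent S, #|S| = 4
    & (\sum_(x in S) deg x < #|G|)%N].
Proof.
move=> vB B4; pose Y := [set y | adj v y && ([set v; y] \in bridges G)].
have YP y : y \in Y -> adj v y /\ [set v; y] \in bridges G by case/setIdP.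
have leBY : (#|bridges G| <= #|Y|)%N.
  apply: leq_trans (leq_imset_card (fun y => [set v; y]) Y).
  apply/subset_leq_card/subsetP=> e eB; have ve := vB e eB.
  have /edgesP[a [b [ab eE]]] : e \in edges G by move: eB; rewrite inE => /andP[].
  move: ve; rewrite eE !inE => /orP[]/eqP vE; subst v; apply/imsetP.
    by exists b => //; apply/setIdP; rewrite -eE.
  exists a; last by rewrite setUC.
  by apply/setIdP; rewrite adj_sym setUC -eE.
(* Deleting [[set v; y]] separates [y] from [v], but not [y'] from [v]. *)
have sep_inj : {in Y &, injective sep_bridges}.
  move=> y y' /YP[vy By] /YP[vy' By'] sep_eq; apply/eqP; apply: contraT => yy'.
  have := mem_sep_bridges vy By; rewrite sep_eq.
  have neq : [set v; y'] != [set v; y].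
    apply: contra yy' => /eqP/setP/(_ y); rewrite !inE eqxx orbT.
    by move/orP=> [/eqP yv|//]; move: vy; rewrite yv adj_irrefl.
  by rewrite !in_set (connect_edge _ vy' neq); case: (_ && _).
have odd_Y y : y \in Y -> odd #|sep_bridges y| = ~~ odd #|sep_bridges v|.
  move=> /YP[vy By]; have := odd_sep_bridges vy By.
  by case: (odd _); case: (odd _).
have [S [sSY S4 _]] := @exists_small_subset _ Y (fun=> 0) 4 (leq_trans B4 leBY).
exists S; split=> //.
  apply/forall_inP => y yS; apply/forall_inP => z zS; apply/negP => yz.
  have [yY zY] := (subsetP sSY _ yS, subsetP sSY _ zS).
  have [B|nB] := boolP ([set y; z] \in bridges G).
    by have := odd_sep_bridges yz B; rewrite (odd_Y y) // (odd_Y z) // eqxx.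
  have := yz; rewrite (sep_inj y z) ?adj_irrefl //.
  exact: sep_bridges_nonbridge yz nB.
have sumS : \sum_(y in S) node_size (sep_bridges y)
            = \sum_(nu in sep_bridges @: S) node_size nu.
  by rewrite big_imset //= => y z yS zS; apply: sep_inj; apply: (subsetP sSY).
have cardS : #|sep_bridges @: S| = 4.
  by rewrite card_in_imset // => y z yS zS; apply: sep_inj; apply: (subsetP sSY).
have sSN : sep_bridges @: S \subset nodes by apply: imsetS; apply: subsetT.
have := sum_node_size; rewrite (big_setID (sep_bridges @: S)) /= (setIidPr sSN) -sumS.
have : (#|nodes :\: sep_bridges @: S| <= \sum_(nu in nodes :\: sep_bridges @: S) node_size nu)%N.
  by rewrite -sum1_card; apply: leq_sum => nu /setDP[/node_size_gt0].
have := cardsD nodes (sep_bridges @: S); rewrite (setIidPr sSN) cardS.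
have : (\sum_(y in S) bdeg y <= #|bridges G|)%N.
  apply: (sum_bdeg_class (b := ~~ odd #|sep_bridges v|)) => y yS.
  exact/odd_Y/(subsetP sSY).
have : (\sum_(y in S) deg y + 4 <= \sum_(y in S) (node_size (sep_bridges y) + bdeg y))%N.
  rewrite -S4 -sum1_card -big_split /=; apply: leq_sum => y _.
  by rewrite addn1 deg_le.
rewrite big_split /=; have := card_bridges_nodes; have := subset_leq_card sSN.
rewrite cardS; move: #|nodes :\: _| #|nodes| #|bridges G| (\sum_(i in nodes :\: _) _).
move: (\sum_(i in S) node_size _) (\sum_(i in S) bdeg i) (\sum_(i in S) deg i).
by move=> *; lia.
Qed.

(** * Free and tight nodes *)

Definition free_nodes : {set {set {set G}}} :=
  [set nu in nodes | (node_bdeg nu < node_size nu)%N].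
Definition tight_nodes (b : bool) : {set {set {set G}}} :=
  [set nu in nodes | (node_size nu <= node_bdeg nu)%N && (odd #|nu| == b)].

Lemma sum_free_tight (F : {set {set G}} -> nat) :
  \sum_(nu in nodes) F nu = \sum_(nu in free_nodes) F nu
    + \sum_(nu in tight_nodes true) F nu + \sum_(nu in tight_nodes false) F nu.
Proof.
rewrite (bigID (fun nu => node_bdeg nu < node_size nu)%N) /= -addnA; congr (_ + _).
  by apply: eq_bigl => nu; rewrite !in_set.
rewrite (bigID (fun nu : {set {set G}} => odd #|nu|)) /=.
by congr (_ + _); apply: eq_bigl => nu; rewrite in_set -leqNgt andbA ?eqb_id ?eqbF_neg.
Qed.

Lemma card_nodes : #|nodes| = #|free_nodes| + #|tight_nodes true| + #|tight_nodes false|.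
Proof. by have := sum_free_tight (fun=> 1); rewrite !sum1_card. Qed.

Lemma sum_tight_lt b : (\sum_(nu in tight_nodes b) node_bdeg nu < #|nodes|)%N.
Proof.
apply: leq_ltn_trans card_bridges_nodes; rewrite sum_nodes.
by apply: (sum_bdeg_class (b := b)) => x; rewrite in_set => /and3P[_ _ /eqP].
Qed.

Lemma sum_node_bdeg : (\sum_(nu in nodes) node_bdeg nu <= 2 * #|bridges G|)%N.
Proof.
rewrite sum_nodes (bigID (fun x => odd #|sep_bridges x|)) /= mul2n -addnn.
apply: leq_add; first by apply: (@sum_bdeg_class _ true) => x /andP[].
by apply: (@sum_bdeg_class _ false) => x /andP[_ /negbTE].
Qed.

(** Bridge ends number at most twice the nodes minus 2, and each free node takes at least one. *)
Lemma sum_tight_le : (1 < #|nodes|)%N ->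
  (\sum_(nu in tight_nodes true) node_bdeg nu + \sum_(nu in tight_nodes false) node_bdeg nu
     + #|free_nodes| + 2 <= 2 * #|nodes|)%N.
Proof.
move=> s1; have := sum_node_bdeg; rewrite sum_free_tight.
have : (#|free_nodes| <= \sum_(nu in free_nodes) node_bdeg nu)%N.
  by rewrite -sum1_card; apply: leq_sum => nu /setIdP[nuN _]; apply: node_bdeg_gt0.
have := card_bridges_nodes.
move: #|free_nodes| #|nodes| #|bridges G| (\sum_(nu in free_nodes) _).
move: (\sum_(nu in tight_nodes true) _) (\sum_(nu in tight_nodes false) _).
by move=> *; lia.
Qed.

Definition free_excess : nat := \sum_(nu in free_nodes) (node_size nu).-1.

Lemma free_excess_le : (free_excess + #|free_nodes| + #|tight_nodes true|
  + #|tight_nodes false| <= #|G|)%N.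
Proof.
have le_tight b : (#|tight_nodes b| <= \sum_(nu in tight_nodes b) node_size nu)%N.
  by rewrite -sum1_card; apply: leq_sum => nu /setIdP[nuN _]; apply: node_size_gt0.
rewrite -sum_node_size sum_free_tight !leq_add // -sum1_card -big_split /=.
by apply: leq_sum => nu /setIdP[/node_size_gt0 q0 _]; rewrite addn1 prednK.
Qed.

(** A free node has a bridge end, hence at least two vertices, and two is impossible. *)
Lemma free_excess_ge : (1 < #|nodes|)%N -> (2 * #|free_nodes| <= free_excess)%N.
Proof.
move=> s1; rewrite mulnC -sum_nat_const; apply: leq_sum => nu /setIdP[nuN lt_dq].
by have := node_bdeg_gt0 nuN s1; have := node_size_neq2 nu; lia.
Qed.

(** [exists_small_subset] selects light nodes of both kinds; as the tight ones share a parity,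
    [exists_independent] applies to their union. *)
Lemma cheap_choice_tight D b : (1 < #|nodes|)%N ->
  (forall S : {set G}, independent S -> #|S| = 4 -> (D <= \sum_(x in S) deg x)%N) ->
  cheap_choice D #|free_nodes| free_excess #|tight_nodes b|
    (\sum_(nu in tight_nodes b) node_bdeg nu).
Proof.
move=> s1 D_min j j4 ja jf.
have [J1 [sJ1 cardJ1 sumJ1]] := exists_small_subset node_bdeg ja.
have [J2 [sJ2 cardJ2 sumJ2]] := exists_small_subset (fun nu => (node_size nu).-1) jf.
have tightJ1 nu : nu \in J1 -> [/\ nu \in nodes, (node_size nu <= node_bdeg nu)%N & odd #|nu| = b].
  by move/(subsetP sJ1); rewrite in_set => /and3P[? ? /eqP].
have freeJ2 nu : nu \in J2 -> nu \in nodes /\ (node_bdeg nu < node_size nu)%N.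
  by move/(subsetP sJ2)/setIdP.
have dis : [disjoint J1 & J2].
  rewrite disjoints_subset; apply/subsetP=> nu /tightJ1[_ qd _]; rewrite in_setC.
  by apply/negP => /freeJ2[_]; rewrite ltnNge qd.
have cardJ : #|J1 :|: J2| = 4.
  by have := cardsUI J1 J2; rewrite (disjoint_setI0 dis) cards0 addn0 => ->;
     rewrite cardJ1 cardJ2 subnKC.
have [||S [S_ind S4 sumS]] := @exists_independent (J1 :|: J2) b.
- by apply/subsetP=> nu /setUP[/tightJ1[]|/freeJ2[]].
- move=> nu /setUP[/tightJ1[]//|/freeJ2[_ lt]] le.
  by move: lt; rewrite ltnNge le.
exists (\sum_(nu in J1) node_bdeg nu), (\sum_(nu in J2) (node_size nu).-1).
have sub_sum (A J : {set {set {set G}}}) (w : {set {set G}} -> nat) :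
    J \subset A -> \sum_(nu in A) w nu = \sum_(nu in J) w nu + \sum_(nu in A :\: J) w nu.
  by move=> sJA; rewrite (big_setID J) /= (setIidPr sJA).
split.
- apply: leq_trans (D_min S S_ind _) _; first by rewrite S4 cardJ.
  apply: leq_trans sumS _.
  have -> : \sum_(nu in J1 :|: J2) node_weight nu
            = \sum_(nu in J1) node_weight nu + \sum_(nu in J2) node_weight nu.
    by rewrite -bigU //=; apply: eq_bigl => nu; rewrite in_setU.
  rewrite leq_add //; apply: leq_sum => nu.
    by move=> /tightJ1[_ qd _]; rewrite /node_weight ltnNge qd.
  by move=> /freeJ2[_ lt]; rewrite /node_weight lt.
- split; first exact: sumJ1.
  rewrite (sub_sum _ _ _ sJ1) leq_add2l.
  have <- : #|tight_nodes b :\: J1| = #|tight_nodes b| - j.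
    by rewrite cardsD (setIidPr sJ1) cardJ1.
  rewrite -sum1_card; apply: leq_sum => nu /setDP[/setIdP[nuN _] _].
  exact: node_bdeg_gt0.
- have [j0|j0] := posnP j.
    have -> : J1 = set0 by apply: cards0_eq; rewrite cardJ1 j0.
    by rewrite big_set0.
  by rewrite (sub_sum _ _ _ sJ1); apply: leq_trans (leq_pmull _ j0); apply: leq_addr.
- split; first exact: sumJ2.
  by rewrite /free_excess (sub_sum _ _ _ sJ2) leq_addr.
have [j0|j0] := posnP (4 - j).
  have -> : J2 = set0 by apply: cards0_eq; rewrite cardJ2 j0.
  by rewrite big_set0.
apply: leq_trans (leq_pmull _ j0).
by rewrite /free_excess (sub_sum _ _ _ sJ2) leq_addr.
Qed.

(** A node with one bridge end is a single vertex of degree at most 1. As [q = 2] is excluded, [q]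
    vertices and [d] bridge ends satisfy [q + 3 <= 2 * d], with 2 added on the right if [d = 1];
    this is summed over the nodes. *)
Lemma leaves_of_tight : (1 < #|nodes|)%N -> #|free_nodes| = 0 ->
  exists2 L : {set G}, {in L, forall x, deg x <= 1}%N & (#|G| + 4 <= #|nodes| + 2 * #|L|)%N.
Proof.
move=> s1 f0; pose L := [set x : G | (deg x <= 1)%N].
exists L; first by move=> x; rewrite inE.
pose leaves := [set nu in nodes | node_bdeg nu == 1].
have tight nu : nu \in nodes -> (node_size nu <= node_bdeg nu)%N.
  move=> nuN; rewrite leqNgt; apply/negP => lt.
  by have /eqP := f0; rewrite cards_eq0 => /eqP/setP/(_ nu); rewrite !in_set nuN lt.
have leL : (#|leaves| <= #|L|)%N.
  apply: leq_trans (leq_imset_card sep_bridges L).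
  apply/subset_leq_card/subsetP=> nu /setIdP[nuN /eqP d1].
  have [x _ nuE] := imsetP nuN; apply/imsetP; exists x => //; rewrite inE.
  have := deg_le x; rewrite -nuE; have := tight nu nuN; rewrite d1.
  have : (bdeg x <= node_bdeg nu)%N.
    by rewrite /node_bdeg (bigD1 x) ?nuE //= leq_addr.
  by rewrite d1; lia.
have : (\sum_(nu in nodes) (node_size nu + 3)
    <= \sum_(nu in nodes) (2 * node_bdeg nu + 2 * (node_bdeg nu == 1%N)))%N.
  apply: leq_sum => nu nuN; have := tight nu nuN; have := node_size_neq2 nu.
  by have := node_bdeg_gt0 nuN s1; lia.
have -> : \sum_(nu in nodes) (node_size nu + 3) = #|G| + #|nodes| * 3.
  by rewrite big_split /= sum_node_size sum_nat_const.
have -> : \sum_(nu in nodes) (2 * node_bdeg nu + 2 * (node_bdeg nu == 1%N))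
          = 2 * \sum_(nu in nodes) node_bdeg nu + 2 * #|leaves|.
  rewrite big_split /= !big_distrr /= -sum1dep_card big_distrr /= big_mkcondr /=.
  by congr (_ + _); apply: eq_bigr => nu _; case: (_ == _).
move: sum_node_bdeg card_bridges_nodes leL.
move: #|L| #|nodes| #|bridges G| #|G| (\sum_(nu in nodes) _) #|leaves|.
by move=> *; lia.
Qed.

End Nodes.

(** Three leaves and their neighbours are at most six vertices, so another vertex [z] completes the
    set; [z] is adjacent neither to itself nor to the leaves. *)
Lemma independent_leaves (G : sgraph) (L : {set G}) :
  connected G -> (6 < #|G|)%N -> (2 < #|L|)%N -> {in L, forall x, deg x <= 1}%N ->
  exists S : {set G}, [/\ independent S, #|S| = 4
    & (\sum_(x in S) deg x < #|G|)%N].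
Proof.
move=> conn n7 L3 L1.
have [K [sKL K3 _]] := @exists_small_subset _ L (fun=> 0) 3 L3.
have {}L1 : {in K, forall x, deg x <= 1}%N by move=> x /(subsetP sKL)/L1.
have nbr1 x y z : x \in K -> adj x y -> adj x z -> y = z.
  by move=> /L1/card_le1_eqP le1 xy xz; apply: le1; rewrite inE.
(* Two adjacent leaves would be the whole graph, by connectedness. *)
have indK x y : x \in K -> y \in K -> ~~ adj x y.
  move=> xK yK; apply/negP => xy.
  have all_xy z : z \in [set x; y].
    have /forallP/(_ x)/forallP/(_ z) := conn.
    move/(connect_ind_closed (A := [in [set x; y]])); apply; last exact: set21.
    move=> a b ab; rewrite !inE => /orP[]/eqP aE; subst a.
      by rewrite (nbr1 x b y) ?eqxx ?orbT.
    by rewrite (nbr1 y b x) ?eqxx // adj_sym.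
  have : (#|G| <= #|[set x; y]|)%N by apply: subset_leq_card; apply/subsetP => z _.
  by rewrite cards2; case: (_ != _); lia.
pose M := K :|: [set y | [exists x in K, adj x y]].
have [z zM] : exists z, z \notin M.
  apply/existsP; apply: contraLR n7; rewrite negb_exists => /forallP allM.
  have leGM : (#|G| <= #|M|)%N.
    by apply: subset_leq_card; apply/subsetP => z _; have := allM z; rewrite negbK.
  rewrite -leqNgt; apply: leq_trans leGM _; apply: leq_trans (leq_card_setU _ _) _.
  rewrite K3 -[6]/(3 + 3)%N leq_add2l -K3.
  pose f (x : G) : G := odflt x [pick y | adj x y].
  apply: leq_trans (leq_imset_card f K); apply/subset_leq_card/subsetP => y.
  rewrite inE => /exists_inP[x xK xy]; apply/imsetP; exists x => //.
  rewrite /f; case: pickP => [y' xy'|/(_ y)]; last by rewrite xy.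
  exact: nbr1 xy xy'.
have zK : z \notin K by apply: contra zM; rewrite inE => ->.
have zadj x : x \in K -> ~~ adj x z.
  move=> xK; apply: contra zM => xz; rewrite !inE; apply/orP; right.
  by apply/exists_inP; exists x.
exists (z |: K); split.
- apply/forall_inP => x /setU1P[->|xK]; apply/forall_inP => y /setU1P[->|yK].
  + by rewrite adj_irrefl.
  + by rewrite adj_sym zadj.
  + exact: zadj.
  + exact: indK.
- by rewrite cardsU1 zK K3.
rewrite (big_setU1 z zK) /=.
have : (\sum_(x in K) deg x <= 3)%N.
  by rewrite -K3 -sum1_card; apply: leq_sum => x /L1.
have : (#|z |: K| + deg z <= #|G|)%N.
  have dis : [disjoint z |: K & [set y | adj z y]].
    rewrite disjoints_subset; apply/subsetP=> x /setU1P[->|xK]; rewrite !inE.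
      by rewrite adj_irrefl.
    by rewrite adj_sym zadj.
  rewrite /deg; have := cardsUI (z |: K) [set y | adj z y].
  by rewrite (disjoint_setI0 dis) cards0 addn0 => <-; apply: max_card.
rewrite cardsU1 zK K3 => le_z le_K; apply: leq_trans le_z.
by rewrite addnC -addSn leq_add2r.
Qed.

(** * Counting bridges *)

(** Index 0 goes to the parity with more tight nodes, which secures [a1 <= a0]. *)
Lemma node_counts (G : sgraph) (r : G) D : connected G -> (1 < #|nodes r|)%N ->
  (forall S : {set G}, independent S -> #|S| = 4 -> (D <= \sum_(x in S) deg x)%N) ->
  exists f W a0 S0 a1 S1,
    [/\ [/\ (a1 <= a0)%N, cheap_choice D f W a0 S0 & cheap_choice D f W a1 S1],
        (S0 < f + a0 + a1)%N /\ (S0 + S1 + f + 2 <= 2 * (f + a0 + a1))%N,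
        (W + f + a0 + a1 <= #|G|)%N, (2 * f <= W)%N
      & f + a0 + a1 = #|nodes r| /\ f = #|free_nodes r|].
Proof.
move=> conn s1 D_min; have card_s := card_nodes r.
have choice b := cheap_choice_tight (b := b) conn s1 D_min.
have lt_S b := sum_tight_lt r conn b; have le_S := sum_tight_le conn s1.
have le_W := free_excess_le r; have W_ge := free_excess_ge conn s1.
exists #|free_nodes r|, (free_excess r).
have [le_a|lt_a] := leqP #|tight_nodes r false| #|tight_nodes r true|.
  exists #|tight_nodes r true|, (\sum_(nu in tight_nodes r true) node_bdeg r nu).
  exists #|tight_nodes r false|, (\sum_(nu in tight_nodes r false) node_bdeg r nu).
  by rewrite -card_s; split.
exists #|tight_nodes r false|, (\sum_(nu in tight_nodes r false) node_bdeg r nu).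
exists #|tight_nodes r true|, (\sum_(nu in tight_nodes r true) node_bdeg r nu).
rewrite -addnA (addnC #|tight_nodes r false|) addnA -card_s.
split; rewrite ?(ltnW lt_a) //.
- by split=> //; rewrite (addnC (\sum_(nu in tight_nodes r false) _)).
- by rewrite addnAC.
Qed.

(** Five bridges make six nodes, all tight by [few_nodes_n]. As [8 <= #|G|], there are three leaves,
    and [independent_leaves] contradicts the degree bound. *)
Lemma few_bridges_order (G : sgraph) :
  connected G -> (8 <= #|G|)%N ->
  (forall S : {set G}, independent S -> #|S| = 4 -> (#|G| <= \sum_(x in S) deg x)%N) ->
  (#|bridges G| <= 4)%N.
Proof.
move=> conn n8 D_min; rewrite leqNgt; apply/negP => b5.
have /card_gt0P[r _] : (0 < #|G|)%N by apply: leq_trans n8.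
have s6 := leq_ltn_trans b5 (card_bridges_nodes r conn).
have s1 : (1 < #|nodes r|)%N by apply: leq_trans s6.
have [f [W [a0 [S0 [a1 [S1 [[le_a c0 c1] [lt_S le_S] le_W W_ge [sE fE]]]]]]]] :=
  node_counts conn s1 D_min.
rewrite -sE in s6.
have [f0 sE6] := few_nodes_n le_a c0 lt_S le_S le_W W_ge s6 (leqnn _).
have [L L1 leL] := leaves_of_tight conn s1 (etrans (esym fE) f0).
have L3 : (2 < #|L|)%N.
  by move: n8 leL; rewrite -sE sE6; move: #|G| #|L| => n l; lia.
have [S [S_ind S4]] := independent_leaves conn (ltnW n8) L3 L1.
by rewrite ltnNge D_min.
Qed.

Lemma few_bridges_numeric (G : sgraph) k D :
  connected G -> (0 < k)%N -> (0 < #|G|)%N ->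
  (forall S : {set G}, independent S -> #|S| = 4 -> (D <= \sum_(x in S) deg x)%N) ->
  (forall f W a0 S0 a1 S1, (a1 <= a0)%N ->
     cheap_choice D f W a0 S0 -> cheap_choice D f W a1 S1 -> (S0 < f + a0 + a1)%N ->
     (S0 + S1 + f + 2 <= 2 * (f + a0 + a1))%N -> (W + f + a0 + a1 <= #|G|)%N ->
     (2 * f <= W)%N -> (k + 2 <= f + a0 + a1)%N -> False) ->
  (#|bridges G| <= k)%N.
Proof.
move=> conn k0 /card_gt0P[r _] D_min absurd; rewrite leqNgt; apply/negP => bk.
have sk := leq_ltn_trans bk (card_bridges_nodes r conn).
have s1 : (1 < #|nodes r|)%N by apply: leq_trans sk.
have [f [W [a0 [S0 [a1 [S1 [[le_a c0 c1] [lt_S le_S] le_W W_ge [sE _]]]]]]]] :=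
  node_counts conn s1 D_min.
by apply: (absurd f W a0 S0 a1 S1) => //; rewrite sE addn2.
Qed.

Lemma sigma_le (G : sgraph) m (S : {set G}) : independent S -> #|S| = m ->
  (sigma G m <= ((\sum_(x in S) deg x)%N%:R)%R%:E)%E.
Proof.
by move=> S_ind Sm; apply: bigmin_le_cond; rewrite S_ind Sm eqxx.
Qed.

(** Of exactly four bridges, either two are disjoint and may share a colour, or all meet at one
    vertex, which [independent_star] rules out. *)
Lemma cf_colorable3 (G : sgraph) : connected G -> (8 <= #|G|)%N ->
  (forall S : {set G}, independent S -> #|S| = 4 -> (#|G| <= \sum_(x in S) deg x)%N) ->
  cf_colorable G 3.
Proof.
move=> conn n8 D_min; have := few_bridges_order conn n8 D_min.
rewrite leq_eqVlt => /orP[/eqP b4|b3]; last exact: cf_colorable_few_bridges.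
have [/existsP[[e f] /and3P[/= eB fB dis]]|] := boolP [exists ef : {set G} * {set G},
    [&& ef.1 \in bridges G, ef.2 \in bridges G & [disjoint ef.1 & ef.2]]].
  exact: cf_colorable_disjoint_bridges b4 eB fB dis.
rewrite negb_exists => /forallP no_dis.
have [] := @intersecting_pairs G (bridges G); first by rewrite b4.
- move=> e; rewrite inE => /andP[/edgesP[u [v [uv ->]]] _].
  rewrite cards2; suff -> : u != v by [].
  by apply: contraTneq uv => ->; rewrite adj_irrefl.
- by move=> e f eB fB; have := no_dis (e, f); rewrite /= eB fB.
move=> v vB; have /card_gt0P[r _] : (0 < #|G|)%N by apply: leq_trans n8.
have [|S [S_ind S4]] := independent_star r conn vB; first by rewrite b4.
by rewrite ltnNge D_min.
Qed.

(** * The five cases of the theorem *)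

Local Open Scope ring_scope.

Theorem theorem4 (G : sgraph) (conn : connected G) (n k : nat)
  (order_G : #|G| = n) (k_ge3 : (3 <= k)%N)
  (H : [/\ k = 3%N, (8 <= n)%N
         & ((2 * n%:R - 7 : rat)%:E <= sigma G 4)%E] \/
       [/\ k = 4%N, (9 <= n)%N
         & ((n%:R : rat)%:E <= sigma G 4)%E] \/
       [/\ k = 5%N, (11 <= n)%N
         & ((n%:R - 1 : rat)%:E <= sigma G 4)%E] \/
       [/\ k = 6%N, (17 <= n)%N
         & (((n%:R + 5) / 2 : rat)%:E <= sigma G 4)%E] \/
       [/\ (7 <= k)%N,
           ((((4 * n%:R - 4 * k%:R - 7) / (k%:R + 2)) : rat)%:E <= sigma G 4)%E
         & [/\ k = 7%N -> (286 <= n)%N,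
               k = 8%N -> (207 <= n)%N,
               k = 9%N -> (190 <= n)%N
             & (10 <= k)%N ->
               (k%:R ^+ 2 + 7 * k%:R + 18 + 33 / (k%:R - 2) : rat) < n%:R]]) :
  (cfc conn <= k)%N.
Proof.
subst n; apply/cfcP; exists k => //.
have D_min x (S : {set G}) : (x%:E <= sigma G 4)%E -> independent S -> #|S| = 4%N ->
    x <= (\sum_(v in S) deg v)%N%:R.
  by move=> le_x S_ind S4; rewrite -lee_fin (le_trans le_x) // sigma_le.
have n_gt0 : (0 < #|G|)%N.
  rewrite lt0n; apply/eqP => n0.
  move: H; rewrite n0 => -[[//]|[[//]|[[//]|[[//]|[k7 _ [n7 n8 n9 n10]]]]]].
  have [kE|[kE|[kE|k10]]] : k = 7%N \/ k = 8%N \/ k = 9%N \/ (10 <= k)%N by lia.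
  - by have := n7 kE.
  - by have := n8 kE.
  - by have := n9 kE.
  have := n10 k10; have : (10 <= k%:R :> rat) by rewrite (ler_nat _ 10).
  move=> k10R; have : 0 <= (k%:R - 2)^-1 :> rat by rewrite invr_ge0; lra.
  by move: (_^-1) => y; nra.
have few b : (b <= k)%N -> (#|bridges G| <= b)%N -> cf_colorable G k.
  move=> bk le_b; apply: cf_colorable_few_bridges => //; first exact: ltnW.
  exact: leq_trans le_b bk.
case: H => [[kE n8 le_sigma]|[[kE n9 le_sigma]|[[kE n11 le_sigma]|[[kE n17 le_sigma]|]]]].
(* For [n >= 8], [2 * n - 7] is at least [n]. *)
- rewrite kE; apply: cf_colorable3 => // S S_ind S4.
  have := D_min _ _ le_sigma S_ind S4; rewrite -(ler_nat rat).
  have : (8 <= #|G|%:R :> rat) by rewrite (ler_nat _ 8).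
  lra.
- apply: (few 4%N); first by rewrite kE.
  apply: few_bridges_order => // [|S S_ind S4]; first exact: ltnW.
  by have := D_min _ _ le_sigma S_ind S4; rewrite ler_nat.
- apply: (few 5%N); first by rewrite kE.
  apply: (@few_bridges_numeric _ _ #|G|.-1) => // [S S_ind S4|f W a0 S0 a1 S1].
    rewrite -ltnS prednK // -(ler_nat rat) -natr1.
    by have := D_min _ _ le_sigma S_ind S4; lra.
  move=> le_a c0 c1 lt_S le_S le_W W_ge sk.
  by apply: (few_nodes_n1 le_a c0 c1 lt_S le_S le_W W_ge sk n11); rewrite leqSpred.
- apply: (few 6%N); first by rewrite kE.
  (* This is [(n + 5) / 2] rounded up. *)
  apply: (@few_bridges_numeric _ _ (#|G| + 6)./2) => // [S S_ind S4|f W a0 S0 a1 S1].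
    have : (#|G| + 5 <= 2 * \sum_(x in S) deg x)%N.
      rewrite -(ler_nat rat) natrD natrM.
      by have := D_min _ _ le_sigma S_ind S4; lra.
    by move: #|G| (\sum_(x in S) _)%N => *; lia.
  move=> le_a c0 c1 lt_S le_S le_W W_ge sk.
  apply: (few_nodes_half le_a c0 c1 lt_S le_S le_W W_ge sk n17).
  by move: #|G| => *; lia.
case=> k7 le_sigma [n7 n8 n9 n10]; apply: (few k) => //.
have k7R : (7 <= k%:R :> rat) by rewrite (ler_nat _ 7).
(* The bound of the last case rounded up; it is 0 when the subtraction truncates. *)
pose D := ((4 * #|G| - (4 * k + 7) + (k + 1)) %/ (k + 2))%N.
apply: (@few_bridges_numeric _ _ D) => // [|S S_ind S4|f W a0 S0 a1 S1].
- exact: leq_trans k7.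
- have : (4 * #|G| <= (\sum_(x in S) deg x) * (k + 2) + 4 * k + 7)%N.
    rewrite -(ler_nat rat) !natrD !natrM !natrD.
    have := D_min _ _ le_sigma S_ind S4; rewrite ler_pdivrMr; last lra.
    by move: (\sum_(x in S) _)%N%:R => t; lra.
  move=> le4; rewrite /D -ltnS ltn_divLR ?addn2 //.
  by move: #|G| (\sum_(x in S) _)%N le4 => *; nia.
move=> le_a c0 c1 lt_S le_S le_W W_ge sk.
apply: (few_nodes_large le_a c0 c1 lt_S le_S le_W W_ge k7 sk) => //.
  rewrite /D; set X := (4 * #|G| - (4 * k + 7) + (k + 1))%N.
  have k2 : (0 < k + 2)%N by rewrite addn2.
  move: (divn_eq X (k + 2)) (ltn_pmod X k2).
  move: (X %/ (k + 2))%N (X %% (k + 2))%N => q m; rewrite /X.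
  by move: #|G| => *; lia.
move/n10 => lt_n; rewrite !expnS !expn0 !muln1 -(ltr_nat rat) !natrD !natrM.
have k2 : 0 < k%:R - 2 :> rat by lra.
(* The left side expands to [k ^ 3 + 5 * k ^ 2 + 4 * k - 3]; the goal is this inequality without
   subtraction. *)
have : (k%:R ^+ 2 + 7 * k%:R + 18) * (k%:R - 2) + 33 < #|G|%:R * (k%:R - 2) :> rat.
  by rewrite -{1}[33](divfK (lt0r_neq0 k2)) -mulrDl ltr_pM2r.
by lra.
Qed.
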